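(* Let $M$ be a connected finite-dimensional topological manifold without boundary, of dimension at least $1$. Then for every integer $k\geq 2$ the configuration space $F(M,k)$ is not contractible; indeed, $F(M,k)$ is not weak-contractible.
   Context: For a topological space $M$ and an integer $k\ge 1$, the (ordered) configuration space is the subspace $F(M,k)=\{(m_1,\ldots,m_k)\in M^k \mid m_i\neq m_j \text{ for all } i\neq j\}$ of $M^k$. A topological space $X$ is weak-contractible if all its homotopy groups are trivial, i.e. $\pi_n(X,x_0)=0$ for all $n\geq 0$ and all choices of base point $x_0\in X$. *)

(* Defs.v *)
From mathcomp Require Import all_boot all_order all_algebra.
From mathcomp Require Import all_classical all_reals topology.
From mathcomp Require Import normedtype.

Set Implicit Arguments.
Unset Strict Implicit.
Unset Printing Implicit Defensive.

Import Order.TTheory GRing.Theory Num.Theory.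
Import numFieldNormedType.Exports.

Local Open Scope classical_set_scope.
Local Open Scope ring_scope.

(* [U], with its subspace topology, is homeomorphic to [V]. *)
Definition homeomorphic_sets (S T : topologicalType) (U : set S) (V : set T)
    : Prop :=
  exists (f : S -> T) (g : T -> S),
    [/\ {within U, continuous f} /\ {within V, continuous g},
        set_fun U V f /\ set_fun V U g,
        (forall x, U x -> g (f x) = x) & (forall y, V y -> f (g y) = y)].

(* Manifolds have no boundary here: charts take values in open subsets of the
   whole of R^n. *)
Record topological_manifold (R : realType) (n : nat) (M : topologicalType)
    : Prop := TopologicalManifold {
  manifold_hausdorff : hausdorff_space M;
  manifold_second_countable : @second_countable M;
  manifold_locally_euclidean : forall x : M,
    exists (U : set M) (V : set 'rV[R]_n),
      [/\ open U, U x, open V & homeomorphic_sets U V]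
}.

Definition config_set (M : topologicalType) (k : nat)
    : set (prod_topology (fun _ : 'I_k => M)) :=
  [set m | forall i j : 'I_k, i <> j -> m i <> m j].

(* [set_type] carries the topology induced by the inclusion in M^k. *)
Definition configuration_space (M : topologicalType) (k : nat)
    : topologicalType :=
  set_type (@config_set M k).

(* [f] and [g], seen as maps D -> X, are homotopic relative to [A]; their
   values outside [D] are irrelevant. *)
Definition homotopic_rel (R : realType) (T X : topologicalType)
    (D A : set T) (f g : T -> X) : Prop :=
  exists H : T * R -> X,
    [/\ {within D `*` `[0, 1], continuous H},
        (forall t, D t -> H (t, 0) = f t),
        (forall t, D t -> H (t, 1) = g t) &
        (forall t (s : R), A t -> 0 <= s <= 1 -> H (t, s) = f t)].

Definition contractible (R : realType) (X : topologicalType) : Prop :=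
  exists x0 : X, @homotopic_rel R X X setT set0 id (cst x0).

Definition cube (R : realType) (n : nat) : set 'rV[R]_n :=
  [set t | forall i, 0 <= t ord0 i <= 1].

Definition cube_boundary (R : realType) (n : nat) : set 'rV[R]_n :=
  [set t | cube t /\ exists i, t ord0 i = 0 \/ t ord0 i = 1].

Section homotopy_groups.
Variables (R : realType) (n : nat) (X : topologicalType) (x0 : X).

Definition based_maps : set ('rV[R]_n -> X) :=
  [set f | {within @cube R n, continuous f} /\
           forall t, cube_boundary t -> f t = x0].

Definition homotopy_class (f : 'rV[R]_n -> X) : set ('rV[R]_n -> X) :=
  [set g | based_maps g /\
           @homotopic_rel R _ X (@cube R n) (@cube_boundary R n) f g].

(* The underlying set of pi_n(X, x0), as homotopy classes of maps of pairs
   (I^n, bd I^n) -> (X, x0).  For n = 0, I^0 is a point with empty boundary,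
   so this is the set of path components of X. *)
Definition homotopy_group : set (set ('rV[R]_n -> X)) :=
  [set homotopy_class f | f in based_maps].

Definition trivial_homotopy_group : Prop :=
  homotopy_group = [set homotopy_class (cst x0)].

End homotopy_groups.

Definition weak_contractible (R : realType) (X : topologicalType) : Prop :=
  forall (n : nat) (x0 : X), trivial_homotopy_group R n x0.

(* Main.v *)
From HB Require Import structures.
Require Import Defs.
From mathcomp Require Import all_boot all_order all_algebra fingroup perm.
From mathcomp Require Import all_classical all_reals topology.
From mathcomp Require Import normedtype derive.
From mathcomp Require Import zify lra.

(** The proof is a Borsuk-Ulam argument.  Exchanging the first two points is an
involution tau of X = F(M,k) without fixed points.

If X is contractible, or only weakly contractible, every map from a sphere to X
extends to the ball (contractible_fillable, weak_contractible_fillable).  As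
for the universal space of the group Z/2, one then builds maps f_j from the
j-cube to X, for all j, with f_j(-t) = tau(f_j(t)) on the boundary: f_(j+1) is
a homotopy relative to the boundary from f_j to tau f_j(-t), where -t is the
point symmetric to t about the centre of the cube.  Two copies of
f_j, one composed with tau, glue to an equivariant map from the j-sphere to X.
Ky Fan's combinatorial form of the Borsuk-Ulam theorem, applied to fine
triangulations of these cubes, shows that N odd real functions on X always have
a common zero on the image of f_N (borsuk_ulam).

On the other hand M has dimension n.  The union theorem of dimension theory
(finely_colourableU) shows that every compact subset of M has arbitrarily fine
finite closed covers with 2^(n+1) colours in which sets of the same colour are
disjoint.  Such a cover gives 2 * 2^(n+1) real functions on M which take
different values at any two points of the compact set that are not close.  The
number N of functions does not depend on the compact set nor on the fineness
(separating_functions), so it may be fixed before f_N is chosen.  With K the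
compact set of all first and second points of the configurations f_N(t), and
phi_1, ..., phi_N separating the first point of each f_N(t) from the second
one, the odd functions phi_i(x_1) - phi_i(x_2) have no common zero on the image
of f_N: a contradiction. *)

Set Implicit Arguments.
Unset Strict Implicit.
Unset Printing Implicit Defensive.
Import Order.TTheory GRing.Theory Num.Theory.
Import numFieldNormedType.Exports.

(** * Prisms over ordered simplices, modulo 2 *)

(** A simplex is the list of its vertices, a chain modulo 2 is a list of simplices,
and a cochain is a boolean function on simplices. *)
Fixpoint facets (T : Type) (s : seq T) : seq (seq T) :=
  if s is v :: s' then s' :: map (cons v) (facets s') else [::].

(** The standard triangulation of the product of a simplex with an interval, mapped
by a on the bottom and by b on the top. *)
Fixpoint prism (S T : Type) (a b : S -> T) (s : seq S) : seq (seq T) :=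
  if s is v :: s' then
    (a v :: map b (v :: s')) :: map (cons (a v)) (prism a b s')
  else [::].

Definition cobd (T : Type) (phi : seq T -> bool) (s : seq T) : bool :=
  \big[addb/false]_(t <- facets s) phi t.

Definition coprism (S T : Type) (a b : S -> T) (phi : seq T -> bool)
    (s : seq S) : bool :=
  \big[addb/false]_(t <- prism a b s) phi t.

Lemma cobd_cons (T : Type) (phi : seq T -> bool) v s :
  cobd phi (v :: s) = phi s (+) cobd (fun t => phi (v :: t)) s.
Proof. by rewrite /cobd /= big_cons big_map. Qed.

Lemma coprism_cons (S T : Type) (a b : S -> T) phi v s :
  coprism a b phi (v :: s) =
  phi (a v :: map b (v :: s)) (+) coprism a b (fun t => phi (a v :: t)) s.
Proof. by rewrite /coprism /= big_cons big_map. Qed.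

Lemma cobdD (T : Type) (phi psi : seq T -> bool) s :
  cobd (fun t => phi t (+) psi t) s = cobd phi s (+) cobd psi s.
Proof. exact: big_split. Qed.

Lemma coprismD (S T : Type) (a b : S -> T) phi psi s :
  coprism a b (fun t => phi t (+) psi t) s =
  coprism a b phi s (+) coprism a b psi s.
Proof. exact: big_split. Qed.

Lemma facets_map (S T : Type) (f : S -> T) s :
  facets (map f s) = map (map f) (facets s).
Proof. by elim: s => //= v s ->; rewrite -!map_comp. Qed.

Lemma cobd_map (S T : Type) (f : S -> T) phi s :
  cobd phi (map f s) = cobd (fun t => phi (map f t)) s.
Proof. by rewrite /cobd facets_map big_map. Qed.

Lemma eq_cobd (T : Type) (phi psi : seq T -> bool) s :
  phi =1 psi -> cobd phi s = cobd psi s.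
Proof. by move=> e; apply: eq_bigr => t _; rewrite e. Qed.

Lemma eq_coprism (S T : Type) (a b : S -> T) phi psi s :
  phi =1 psi -> coprism a b phi s = coprism a b psi s.
Proof. by move=> e; apply: eq_bigr => t _; rewrite e. Qed.

(** The boundary of a prism is its bottom, its top and the prism over the boundary;
the interior faces cancel in pairs. *)
Lemma coprism_cobd (S T : Type) (a b : S -> T) phi s :
  coprism a b (cobd phi) s =
  phi (map a s) (+) phi (map b s) (+) cobd (coprism a b phi) s.
Proof.
elim: s phi => [|v s IH] phi.
  by rewrite /coprism /cobd /= !big_nil; case: (phi _).
rewrite coprism_cons !map_cons !cobd_cons.
rewrite (@eq_coprism _ _ a b _
  (fun t => phi t (+) cobd (fun u => phi (a v :: u)) t)); last first.
  by move=> t; rewrite cobd_cons.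
rewrite coprismD IH cobd_map.
rewrite (@eq_cobd _ (fun t => coprism a b phi (v :: t))
  (fun t => phi [:: a v, b v & map b t] (+)
    coprism a b (fun u => phi (a v :: u)) t)); last first.
  by move=> t; rewrite coprism_cons.
rewrite cobdD.
move: (phi _) (phi _) (phi _) (cobd _ s) (coprism _ _ _ _) (cobd _ s).
by do 6![case].
Qed.

Lemma coprism_rcons (S T : Type) (a b : S -> T) phi s v :
  coprism a b phi (rcons s v) =
  phi (rcons (map a (rcons s v)) (b v)) (+)
  coprism a b (fun t => phi (rcons t (b v))) s.
Proof.
elim: s phi => [|w s IH] phi.
  by rewrite /= coprism_cons /coprism /= !big_nil.
rewrite rcons_cons !coprism_cons IH !map_cons map_rcons !rcons_cons.
by rewrite addbCA.
Qed.

(** Reversing the order of the vertices of the base turns the triangulation of the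
prism upside down. *)
Lemma coprism_rev (S T : Type) (a b : S -> T) phi s :
  coprism b a (fun t => phi (rev t)) (rev s) = coprism a b phi s.
Proof.
elim: s phi => [|v s IH] phi; first by rewrite /coprism /= !big_nil.
rewrite coprism_cons -IH rev_cons coprism_rcons; congr (_ (+) _).
  by rewrite rev_rcons -map_rev rev_rcons revK.
by apply: eq_coprism => t; rewrite rev_rcons.
Qed.

(** For a symmetric cochain the coboundary is a sum over the multiset of vertices,
hence it is symmetric again. *)
Lemma cobd_rem (T : eqType) (phi : seq T -> bool) s :
  (forall t u, perm_eq t u -> phi t = phi u) ->
  cobd phi s = \big[addb/false]_(x <- s) phi (rem x s).
Proof.
elim: s phi => [|v s IH] phi phiP; first by rewrite /cobd !big_nil.
rewrite cobd_cons big_cons /= eqxx; congr (_ (+) _).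
rewrite IH; last by move=> t u tu; apply: phiP; rewrite perm_cons.
apply: eq_big_seq => x xs; case: eqP => [->|//].
by apply: phiP; rewrite perm_sym perm_to_rem.
Qed.

Lemma cobd_perm (T : eqType) (phi : seq T -> bool) s s' :
  (forall t u, perm_eq t u -> phi t = phi u) ->
  perm_eq s s' -> cobd phi s = cobd phi s'.
Proof.
move=> phiP ss'; rewrite !cobd_rem // (perm_big _ ss') /=.
apply: eq_big_seq => x xs'; apply: phiP; rewrite -(perm_cons x).
have xs : x \in s by rewrite (perm_mem ss').
rewrite -(permPl (perm_to_rem xs)) -(permPr (perm_to_rem xs')) //.
Qed.

(** * Alternating labels *)

Fixpoint alternates (b : bool) (s : seq bool) : bool :=
  if s is x :: s' then (x == b) && alternates (~~ b) s' else true.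

(** The combinatorial heart of Ky Fan's lemma.  If s has two equal neighbours, deleting
one or the other gives the same sequence, and any other deletion leaves them
in place, so the sum vanishes.  If s alternates, only the deletion of an end
preserves this, and exactly one of the two ends leaves a sequence which starts
with b. *)
Lemma cobd_alternates b s :
  cobd (alternates b) s = alternates b s (+) alternates (~~ b) s.
Proof.
elim: s b => [|x s IH] b; first by rewrite /cobd big_nil.
rewrite cobd_cons /=.
have [->|xb] := eqVneq x b.
  by rewrite IH; case: b; case: alternates; case: alternates.
rewrite /cobd big1 //; case: x b xb => [] [] //= _; rewrite addbF //.
Qed.

Lemma alternates_negb b s :
  alternates b (map negb s) = alternates (~~ b) s.
Proof. by elim: s b => //= x s IH b; rewrite IH; case: x; case: b. Qed.

(** The label l stands for the index l./2 with the sign odd l; opp_label changes the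
sign. *)
Definition opp_label (l : nat) : nat := l./2.*2 + ~~ odd l.

Lemma odd_opp_label l : odd (opp_label l) = ~~ odd l.
Proof. by rewrite /opp_label oddD odd_double oddb. Qed.

(** No two labels of s are opposite. *)
Definition consistent (s : seq nat) :=
  {in s &, forall x y, x./2 = y./2 -> x = y}.

(** Sorting the labels puts them in the order of their indices, which makes this
cochain symmetric. *)
Definition alt_labels (b : bool) (s : seq nat) : bool :=
  alternates b (map odd (sort leq s)).

Lemma alt_labels_perm b s t : perm_eq s t -> alt_labels b s = alt_labels b t.
Proof.
by move=> st; rewrite /alt_labels (perm_sortP leq_total leq_trans anti_leq _ _ st).
Qed.

Lemma cobd_alt_labels b s :
  cobd (alt_labels b) s = alt_labels b s (+) alt_labels (~~ b) s.
Proof.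
have sP : perm_eq s (sort leq s) by rewrite perm_sym perm_sort.
rewrite (cobd_perm (@alt_labels_perm b) sP) /alt_labels -cobd_alternates cobd_map.
apply: eq_big_seq => t ts.
suff st : sorted leq t by rewrite sorted_sort //; exact: leq_trans.
have : sorted leq (sort leq s) by apply: sort_sorted; exact: leq_total.
apply: subseq_sorted; first exact: leq_trans.
elim: (sort leq s) t ts => //= v l IH t; rewrite inE => /orP[/eqP ->|].
  exact: subseq_cons.
by case/mapP => u ul ->; rewrite eqxx; apply: IH.
Qed.

(** Without opposite labels in s, changing all signs preserves the order of the
labels. *)
Lemma alt_labels_opp b s :
  consistent s -> alt_labels b (map opp_label s) = alt_labels (~~ b) s.
Proof.
move=> cs; rewrite /alt_labels.
have -> : sort leq (map opp_label s) = map opp_label (sort leq s).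
  apply: (sorted_eq leq_trans anti_leq).
  - by apply: sort_sorted; exact: leq_total.
  - rewrite sorted_map; apply: (@sub_in_sorted _ (mem s) leq); last first.
    + by apply: sort_sorted; exact: leq_total.
    + by apply/allP => x; rewrite mem_sort.
    move=> x y xs ys xy /=; rewrite /opp_label.
    have [e|ne] := eqVneq x./2 y./2; first by rewrite (cs x y xs ys e).
    by case: odd; case: odd => /=; lia.
  - apply: perm_trans; first by rewrite perm_sort.
    by apply: perm_map; rewrite perm_sym perm_sort.
rewrite -map_comp -alternates_negb -map_comp; congr alternates.
by apply: eq_map => x /=; rewrite odd_opp_label.
Qed.

Lemma alt_labels_uniq b s : alt_labels b s -> uniq s.
Proof.
rewrite /alt_labels -(sort_uniq leq s) => h.
suff st : sorted ltn (sort leq s) by apply: (sorted_uniq ltn_trans ltnn st).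
have : sorted leq (sort leq s) by apply: sort_sorted; exact: leq_total.
case: (sort leq s) h => //= x l /andP[/eqP <-] {b}.
elim: l x => //= y l IH x /andP[/eqP oy al] /andP[xy lP].
rewrite IH // ?andbT ?oy //; rewrite ltn_neqAle xy andbT.
by apply/eqP => e; move: oy; rewrite e; case: odd.
Qed.

(** The indices of an alternating consistent family are pairwise different. *)
Lemma alt_labels_size b s N :
  consistent s -> {in s, forall x, x < N.*2} -> N < size s ->
  alt_labels b s = false.
Proof.
move=> cs sN Ns; apply: contraTF Ns => /alt_labels_uniq us; rewrite -leqNgt.
rewrite -(size_map half) -(size_iota 0 N); apply: uniq_leq_size.
  by rewrite map_inj_in_uniq.
by move=> _ /mapP[x /sN xN ->]; rewrite mem_iota; lia.
Qed.

Local Open Scope classical_set_scope.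
Local Open Scope ring_scope.

(** * Continuity on subsets *)

Lemma within_comp (S T U : topologicalType) (A : set S) (B : set T)
    (f : S -> T) (g : T -> U) :
  (forall x, A x -> B (f x)) -> {within A, continuous f} ->
  {within B, continuous g} -> {within A, continuous (g \o f)}.
Proof.
move=> fAB /subspace_continuousP cf /subspace_continuousP cg.
apply/subspace_continuousP => x Ax.
apply: cvg_comp (cg _ (fAB x Ax)).
move=> W WB.
have h : within A (nbhs x) (fun y => B (f y) -> W (f y)) by exact: cf x Ax _ WB.
rewrite /fmap /=; move: h; rewrite /within /=.
by apply: filterS => y fW Ay; apply: fW => //; apply: fAB.
Qed.

Lemma within_eq (S T : topologicalType) (A : set S) (f g : S -> T) :
  (forall x, A x -> f x = g x) ->
  {within A, continuous f} -> {within A, continuous g}.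
Proof.
move=> fg; apply: subspace_eq_continuous => x /set_mem; exact: fg.
Qed.

Lemma within_pair (S T U : topologicalType) (A : set S)
    (f : S -> T) (g : S -> U) :
  {within A, continuous f} -> {within A, continuous g} ->
  {within A, continuous (fun x => (f x, g x))}.
Proof. by move=> cf cg x; apply: cvg_pair; [exact: cf | exact: cg]. Qed.

Lemma pair_continuous_at (S T U : topologicalType) (f : S -> T) (g : S -> U) x :
  {for x, continuous f} -> {for x, continuous g} ->
  {for x, continuous (fun x => (f x, g x))}.
Proof. by move=> cf cg; apply: cvg_pair; [exact: cf | exact: cg]. Qed.

Lemma cvg_mx (S : Type) (F : set_system S) (FF : Filter F) (R : realType)
    m n (f : S -> 'M[R]_(m, n)) (l : 'M[R]_(m, n)) :
  (forall i j, f x i j @[x --> F] --> l i j) -> f @ F --> l.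
Proof.
move=> fl W [P nP PW].
have : \forall x \near F, forall ij : 'I_m * 'I_n, P ij.1 ij.2 (f x ij.1 ij.2).
  by apply: filter_forall => -[i j]; exact: fl.
by rewrite /fmap /=; apply: filterS => x Px; apply: PW => i j; exact: (Px (i, j)).
Qed.

Lemma mx_continuous (T : topologicalType) (R : realType) m n
    (f : T -> 'M[R]_(m, n)) :
  (forall i j, continuous (fun y => f y i j)) -> continuous f.
Proof.
by move=> cf x; apply: (@cvg_mx T (nbhs x) _ R m n f (f x)) => i j; exact: cf.
Qed.

(** * Extending maps from spheres to balls *)

Section extension.
Variable R : realType.

Definition ball1 (V : normedModType R) : set V := [set v | `|v| <= 1].
Definition sphere1 (V : normedModType R) : set V := [set v | `|v| = 1].

(** The norm of 'rV[R]_j * R is the maximum norm, so that the unit ball is a cube of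
dimension j + 1 with a distinguished last coordinate. *)
Definition sphere_fillable (X : topologicalType) : Prop :=
  forall (j : nat) (F : 'rV[R]_j * R -> X),
    {within @sphere1 ('rV[R]_j * R)%type, continuous F} ->
    exists2 G, {within @ball1 ('rV[R]_j * R)%type, continuous G} &
      forall u, sphere1 u -> G u = F u.

Lemma closed_norm_le (V : normedModType R) (c : R) : closed [set v : V | `|v| <= c].
Proof.
apply: (closed_comp (f := fun v : V => `|v|) (D := [set x : R | x <= c])).
  by move=> v _; exact: norm_continuous.
exact: closed_le.
Qed.

Lemma closed_norm_ge (V : normedModType R) (c : R) : closed [set v : V | c <= `|v|].
Proof.
apply: (closed_comp (f := fun v : V => `|v|) (D := [set x : R | c <= x])).
  by move=> v _; exact: norm_continuous.
exact: closed_ge.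
Qed.

Lemma norm_normalize (V : normedModType R) (v : V) :
  v != 0 -> `| `|v|^-1 *: v| = 1.
Proof.
move=> v0; rewrite normrZ normfV normr_id mulVf //.
by rewrite normr_eq0.
Qed.

Lemma normalize_continuous (V : normedModType R) (v : V) :
  v != 0 -> {for v, continuous (fun v : V => `|v|^-1 *: v)}.
Proof.
move=> v0; apply: cvgZ; last exact: cvg_id.
apply: cvgV; first by rewrite normr_eq0.
exact: norm_continuous.
Qed.

(** The homotopy H fills the shell between the spheres of radius 1/2 and 1, and G0
fills the ball of radius 1/2. *)
Lemma collar_extension (V : normedModType R) (X : topologicalType)
    (F G0 : V -> X) (H : V * R -> X) :
  {within @sphere1 V `*` [set s : R | 0 <= s <= 1], continuous H} ->
  (forall u, sphere1 u -> H (u, 0) = F u) ->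
  {within @ball1 V, continuous G0} ->
  (forall u, sphere1 u -> G0 u = H (u, 1)) ->
  exists2 G, {within @ball1 V, continuous G} &
    forall u, sphere1 u -> G u = F u.
Proof.
move=> cH H0 cG0 H1.
pose c (v : V) := (`|v|^-1 *: v, 2 * (1 - `|v|)).
pose G v := if `|v| <= 2^-1 then G0 (2 *: v) else H (c v).
exists G; last first.
  move=> u; rewrite /sphere1 /= /G /c => u1.
  rewrite u1 ifF; last by apply/negbTE; rewrite -ltNge; lra.
  by rewrite subrr mulr0 invr1 scale1r H0.
pose A := [set v : V | `|v| <= 2^-1].
pose B := [set v : V | 2^-1 <= `|v|] `&` @ball1 V.
have -> : @ball1 V = A `|` B.
  apply/seteqP; split=> v; rewrite /A /B /ball1 /=.
    by move=> v1; have [?|/ltW ?] := leP `|v| 2^-1; [left|right].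
  by case=> [|[]//] ?; lra.
apply: withinU_continuous.
- exact: closed_norm_le.
- by apply: closedI; [exact: closed_norm_ge | exact: closed_norm_le].
- apply: (@within_eq _ _ _ (G0 \o (fun v => 2 *: v))).
    by move=> v; rewrite /A /G /= => ->.
  apply: (within_comp _ _ cG0).
    by move=> v; rewrite /A /ball1 /= normrZ ger0_norm //; lra.
  by apply: continuous_subspaceT => v; apply: cvgZ; [exact: cvg_cst|exact: cvg_id].
- have Bn0 v : B v -> v != 0.
    by rewrite /B /= -normr_gt0 => -[? _]; lra.
  apply: (@within_eq _ _ _ (H \o c)).
    move=> v Bv; case: (Bv); rewrite /ball1 /= => v2 v1; rewrite /G /=.
    case: ifPn => // v3.
    have v4 : `|v| = 2^-1 by apply/eqP; rewrite eq_le v3 v2.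
    rewrite H1; first by rewrite /c v4 invrK; congr (H (_, _)); lra.
    by rewrite /sphere1 /= normrZ v4 ger0_norm //; lra.
  apply: (within_comp _ _ cH).
    move=> v Bv; case: (Bv) => v1 v2; split; first exact: norm_normalize (Bn0 v Bv).
    by move: v1 v2; rewrite /ball1 /=; lra.
  apply: continuous_in_subspaceT => v /set_mem /Bn0 v0.
  refine (@pair_continuous_at V V R (fun v => `|v|^-1 *: v) (fun v => 2 * (1 - `|v|)) v _ _); first exact: normalize_continuous.
  apply: cvgM; first exact: cvg_cst.
  by apply: cvgB; [exact: cvg_cst|exact: norm_continuous].
Qed.

Lemma contractible_fillable (X : topologicalType) :
  contractible R X -> sphere_fillable X.
Proof.
move=> [x0 [H [cH H0 H1 _]]] j F cF.
apply: (@collar_extension _ _ _ (cst x0) (fun p => H (F p.1, p.2))).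
- apply: (within_comp (f := fun p => (F p.1, p.2)) _ _ cH).
    by move=> p [_ /= ?]; split => //=; rewrite in_itv.
  apply: within_pair.
    apply: (within_comp _ _ cF); first by move=> p [].
    by apply: continuous_subspaceT => p; exact: cvg_fst.
  by apply: continuous_subspaceT => p; exact: cvg_snd.
- by move=> u _; rewrite H0.
- by apply: continuous_subspaceT => p; exact: cvg_cst.
- by move=> u _; rewrite H1.
Qed.

(** The cube [0,1]^j is identified with the unit ball [-1,1]^j of the maximum norm. *)
Definition cube_to_ball (j : nat) (t : 'rV[R]_j) : 'rV[R]_j := 2 *: t - const_mx 1.
Definition ball_to_cube (j : nat) (w : 'rV[R]_j) : 'rV[R]_j :=
  2^-1 *: (w + const_mx 1).

Lemma cube_to_ballK j : cancel (@cube_to_ball j) (@ball_to_cube j).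
Proof. by move=> t; rewrite /ball_to_cube subrK scalerA mulVf ?scale1r ?pnatr_eq0. Qed.

Lemma ball_to_cubeK j : cancel (@ball_to_cube j) (@cube_to_ball j).
Proof. by move=> t; rewrite /cube_to_ball scalerA divff ?pnatr_eq0 // scale1r addrK. Qed.

Lemma rV_norm_le j (w : 'rV[R]_j) (c : R) : 0 <= c ->
  `|w| <= c <-> forall i, `|w ord0 i| <= c.
Proof.
move=> c0; rewrite [`|w|]mx_normrE; split=> [wc i|wc].
  apply: le_trans wc.
  by apply/bigmax_geP; right; exists (ord0, i).
by apply/bigmax_leP; split => // -[i k] _ /=; rewrite ord1.
Qed.

Lemma cube_ball j (t : 'rV[R]_j) : cube t <-> ball1 (cube_to_ball t).
Proof.
rewrite /ball1 /= rV_norm_le //; split=> h i; have := h i;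
  rewrite !mxE ler_norml; lra.
Qed.

Lemma cube_boundary_sphere j (t : 'rV[R]_j) :
  cube_boundary t <-> sphere1 (cube_to_ball t).
Proof.
split=> [[/cube_ball tc [i ti]]|t1].
  apply/eqP; rewrite eq_le tc /=.
  have -> : 1 = `|cube_to_ball t ord0 i|.
    rewrite !mxE; case: ti => ->; first by rewrite mulr0 sub0r normrN normr1.
    have -> : 2 * 1 - 1 = 1 :> R by lra.
    by rewrite normr1.
  exact: ((rV_norm_le _ (normr_ge0 _)).1 (lexx _) i).
split; first by apply/cube_ball; rewrite /ball1 /= t1.
have : mx_norm (cube_to_ball t) != 0 by rewrite [mx_norm _]t1 oner_neq0.
move=> /mx_norm_neq0[[i k]]; rewrite [mx_norm _]t1 /= ord1 => e; exists k.
move: e; rewrite !mxE; case: (ler0P (2 * t 0 k - 1)) => _ e; [left|right]; lra.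
Qed.

Lemma affine_continuous (V : normedModType R) (a : R) (b : V) :
  continuous (fun x : V => a *: x + b).
Proof.
move=> x; apply: cvgD; last exact: cvg_cst.
by apply: cvgZ; [exact: cvg_cst|exact: cvg_id].
Qed.

Lemma cube_to_ball_continuous j : continuous (@cube_to_ball j).
Proof. exact: (@affine_continuous 'rV[R]_j 2 (- const_mx 1)). Qed.

Lemma ball_to_cube_continuous j : continuous (@ball_to_cube j).
Proof.
have -> : @ball_to_cube j = fun w => 2^-1 *: w + 2^-1 *: const_mx 1.
  by apply/funext => w; rewrite /ball_to_cube scalerDr.
exact: (@affine_continuous 'rV[R]_j 2^-1).
Qed.

Lemma cube_of_ball j (w : 'rV[R]_j) : ball1 w -> cube (ball_to_cube w).
Proof. by move=> h; apply/cube_ball; rewrite ball_to_cubeK. Qed.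

Lemma closed_cube j : closed (@cube R j).
Proof.
have -> : @cube R j = (@cube_to_ball j) @^-1` (@ball1 'rV[R]_j).
  by apply/seteqP; split=> t; rewrite /preimage /= => /cube_ball.
apply: closed_comp; first by move=> t _; exact: cube_to_ball_continuous.
exact: closed_norm_le.
Qed.

Lemma prod_norm_le (U V : normedModType R) (p : U * V) (c : R) :
  (`|p| <= c) = (`|p.1| <= c) && (`|p.2| <= c).
Proof. by rewrite [`|p|]/(Num.max `|p.1| `|p.2|) ge_max. Qed.

Lemma prod_norm_eq (U V : normedModType R) (p : U * V) (c : R) :
  `|p| = c <-> [/\ `|p.1| <= c, `|p.2| <= c & `|p.1| = c \/ `|p.2| = c].
Proof.
rewrite [`|p|]/(Num.max `|p.1| `|p.2|).
case: leP => [pp|/ltW pp]; split=> [<-|[p1 p2 [e|e]]] //.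
- by split => //; left.
- by apply/eqP; rewrite eq_le p1 -e pp.
- by split => //; right.
- by apply/eqP; rewrite eq_le p2 -e pp.
Qed.

(** The maps f and g, put on the bottom and on the top of a cube, extend to the sides
by their common boundary values, and the filling of this sphere is the homotopy. *)
Lemma fillable_homotopy (X : topologicalType) : sphere_fillable X ->
  forall j (f g : 'rV[R]_j -> X),
    {within @cube R j, continuous f} -> {within @cube R j, continuous g} ->
    (forall t, cube_boundary t -> f t = g t) ->
    @homotopic_rel R _ X (@cube R j) (@cube_boundary R j) f g.
Proof.
move=> fillX j f g cf cg fg.
pose F (p : 'rV[R]_j * R) := if p.2 == 1 then g (ball_to_cube p.1) else f (ball_to_cube p.1).
have Ff (p : 'rV[R]_j * R) : sphere1 p -> p.2 <> 1 \/ `|p.1| = 1 -> F p = f (ball_to_cube p.1).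
  move=> p1; rewrite /F; case: eqP => // p2 [//|q1].
  by rewrite fg //; apply/cube_boundary_sphere; rewrite ball_to_cubeK.
case: (fillX j F) => [|G cG GF].
  pose A := @sphere1 ('rV[R]_j * R)%type `&` [set p | p.2 = 1].
  pose B := @sphere1 ('rV[R]_j * R)%type `&` ([set p | p.2 = -1] `|` [set p | `|p.1| = 1]).
  have csph : closed (@sphere1 ('rV[R]_j * R)%type).
    have -> : @sphere1 ('rV[R]_j * R)%type =
      [set v | `|v| <= 1] `&` [set v | 1 <= `|v|].
      apply/seteqP; split=> v; rewrite /sphere1 /=; first by move=> ->.
      by move=> [? ?]; apply/eqP; rewrite eq_le; apply/andP.
    by apply: closedI; [exact: closed_norm_le|exact: closed_norm_ge].
  have cunc : continuous (fun p : 'rV[R]_j * R => ball_to_cube p.1).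
    by move=> p; apply: continuous_comp; [exact: cvg_fst|exact: ball_to_cube_continuous].
  have cb (p : 'rV[R]_j * R) : sphere1 p -> cube (ball_to_cube p.1).
    by move=> /prod_norm_eq[? _ _]; exact: cube_of_ball.
  have -> : @sphere1 ('rV[R]_j * R)%type = A `|` B.
    apply/seteqP; split=> p; last by case=> [[]|[]].
    move=> p1; have [e|ne] := eqVneq p.2 1; first by left.
    right; split=> //; case/prod_norm_eq: p1 => _ _ [|e]; first by right.
    left; move: e ne; rewrite /=; case: ler0P => _ e; first by move=> _; lra.
    by rewrite e eqxx.
  apply: withinU_continuous.
  - apply: closedI => //; apply: (closed_comp (f := fun p : 'rV[R]_j * R => p.2) (D := [set 1])).
      by move=> p _; exact: cvg_snd.
    exact: closed_eq.
  - apply: closedI => //; apply: closedU.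
      apply: (closed_comp (f := fun p : 'rV[R]_j * R => p.2) (D := [set -1])); last exact: closed_eq.
      by move=> p _; exact: cvg_snd.
    apply: (closed_comp (f := fun p : 'rV[R]_j * R => `|p.1|) (D := [set 1])); last exact: closed_eq.
    by move=> p _; apply: cvg_norm; exact: cvg_fst.
  - apply: (@within_eq _ _ _ (g \o (fun p => ball_to_cube p.1))).
      by move=> p [_ /= p2]; rewrite /F p2 eqxx.
    apply: (within_comp _ _ cg); first by move=> p [/cb].
    exact: continuous_subspaceT.
  - apply: (@within_eq _ _ _ (f \o (fun p => ball_to_cube p.1))).
      move=> p [p1 p2]; rewrite /= Ff //; case: p2 => /= [->|]; last by right.
      by left; lra.
    apply: (within_comp _ _ cf); first by move=> p [/cb].
    exact: continuous_subspaceT.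
exists (fun p => G (cube_to_ball p.1, 2 * p.2 - 1)); split.
- apply: (within_comp (f := fun p : 'rV[R]_j * R => (cube_to_ball p.1, 2 * p.2 - 1)) _ _ cG).
    move=> [t s] [/= /cube_ball tc]; rewrite in_itv /= => s01.
    rewrite /ball1 /= prod_norm_le; apply/andP; split; first exact: tc.
    by rewrite /= ler_norml; lra.
  apply: within_pair; apply: continuous_subspaceT => p.
    by apply: continuous_comp; [exact: cvg_fst|exact: cube_to_ball_continuous].
  apply: cvgB; last exact: cvg_cst.
  by apply: cvgM; [exact: cvg_cst|exact: cvg_snd].
- move=> t /cube_ball tc; rewrite mulr0 sub0r.
  have p1 : @sphere1 ('rV[R]_j * R)%type (cube_to_ball t, -1).
    by apply/prod_norm_eq; rewrite /= normrN normr1; split => //; right.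
  by rewrite GF // Ff //= ?cube_to_ballK //; left; lra.
- move=> t /cube_ball tc; rewrite mulr1; have -> : 2 - 1 = 1 :> R by lra.
  rewrite GF; first by rewrite /F /= eqxx cube_to_ballK.
  apply/prod_norm_eq.
  by rewrite /= normr1; split => //; right.
- move=> t s /cube_boundary_sphere tc s01.
  have p1 : @sphere1 ('rV[R]_j * R)%type (cube_to_ball t, 2 * s - 1).
    apply/prod_norm_eq; rewrite /= [`|cube_to_ball t|]tc; split => //; last by left.
    by rewrite ler_norml; lra.
  by rewrite GF // Ff //= ?cube_to_ballK //; right.
Qed.
End extension.

Section weak.
Variable R : realType.

Lemma based_null_homotopic (X : topologicalType) (x0 : X) j (f : 'rV[R]_j -> X) :
  weak_contractible R X -> based_maps x0 f ->
  @homotopic_rel R _ X (@cube R j) (@cube_boundary R j) f (cst x0).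
Proof.
move=> wX bf.
have bc : based_maps x0 (cst x0 : 'rV[R]_j -> X).
  by split=> //; apply: continuous_subspaceT => t; exact: cst_continuous.
have : homotopy_group x0 (homotopy_class x0 f) by exists f.
rewrite wX /= => e.
suff : homotopy_class x0 f (cst x0) by case.
rewrite e; split=> //; exists (cst x0); split=> //.
by apply: continuous_subspaceT => t; exact: cst_continuous.
Qed.

(** The straight-line homotopy from the identity of the unit sphere to the map
  (w, h) |-> ((1-|w|)(1+h)/2 w, (1+h)(1-|w|) - 1),
which sends the bottom and the sides to (0, -1) and wraps the top over the
whole sphere.  Normalized, it deforms the sphere so that everything outside the
top is collapsed to one point. *)
Definition sweep (E : normedModType R) (q : E * R * R) : E * R :=
  ((1 - q.2 + q.2 * ((1 - `|q.1.1|) * (1 + q.1.2) / 2)) *: q.1.1,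
   (1 - q.2) * q.1.2 + q.2 * ((1 + q.1.2) * (1 - `|q.1.1|) - 1)).

Lemma sweep_continuous (E : normedModType R) : continuous (@sweep E).
Proof.
move=> q.
have c1 : {for q, continuous (fun q : E * R * R => q.1.1)}.
  by apply: (continuous_comp (f := fst) (g := fst)); exact: cvg_fst.
have c2 : {for q, continuous (fun q : E * R * R => q.1.2)}.
  by apply: (continuous_comp (f := fst) (g := snd)); [exact: cvg_fst|exact: cvg_snd].
have c3 : {for q, continuous (fun q : E * R * R => q.2)} by exact: cvg_snd.
have cn : {for q, continuous (fun q : E * R * R => `|q.1.1|)}.
  by apply: cvg_norm; exact: c1.
refine (@pair_continuous_at (E * R * R)%type E R
  (fun q : E * R * R => (1 - q.2 + q.2 * ((1 - `|q.1.1|) * (1 + q.1.2) / 2)) *: q.1.1)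
  (fun q : E * R * R => (1 - q.2) * q.1.2 + q.2 * ((1 + q.1.2) * (1 - `|q.1.1|) - 1)) q _ _).
- apply: cvgZ => //; apply: cvgD; first by apply: cvgB => //; exact: cvg_cst.
  apply: cvgM => //; apply: cvgM; last exact: cvg_cst.
  by apply: cvgM; [apply: cvgB|apply: cvgD] => //; exact: cvg_cst.
- apply: cvgD; first by apply: cvgM => //; apply: cvgB => //; exact: cvg_cst.
  apply: cvgM => //; apply: cvgB; last exact: cvg_cst.
  by apply: cvgM; [apply: cvgD|apply: cvgB] => //; exact: cvg_cst.
Qed.

Lemma sweep_neq0 (E : normedModType R) (p : E * R) (s : R) :
  sphere1 p -> 0 <= s <= 1 -> sweep (p, s) != 0.
Proof.
case: p => w h /prod_norm_eq /= [w1 h1 wh] s01.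
apply/eqP => -[] /= /(congr1 Num.norm); rewrite normrZ normr0 => /eqP.
rewrite mulf_eq0 !normr_eq0 -(normr_eq0 w) => aw b.
have r0 : 0 <= `|w| by [].
move: aw b r0 w1 wh; move: `|w| => r; case/orP => /eqP.
- move=> a b r0 r1 [r1'|]; first by subst r; nra.
  by case: ler0P => _ h1'; [have e : h = -1 by lra | have e : h = 1 by lra]; subst h; nra.
- move=> -> b _ _ [|]; first by move=> /eqP; rewrite eq_sym oner_eq0.
  by case: ler0P => _ h1'; [have e : h = -1 by lra | have e : h = 1 by lra]; subst h; nra.
Qed.

Lemma sweep0 (E : normedModType R) (p : E * R) : sweep (p, 0) = p.
Proof. by case: p => w h; rewrite /sweep /= !subr0 !mul0r !addr0 scale1r mul1r. Qed.

Lemma sweep1_sides (E : normedModType R) (p : E * R) :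
  sphere1 p -> p.2 <> 1 \/ `|p.1| = 1 -> sweep (p, 1) = (0, -1).
Proof.
case: p => w h /prod_norm_eq /= [w1 h1 wh] J.
have {J} [r1|h1'] : `|w| = 1 \/ h = -1.
  case: wh => [|]; first by left.
  case: J; last by left.
  by case: ler0P => _ h2 h3; right; lra.
- by rewrite /sweep /= r1 !subrr !(mul0r, mulr0) addr0 scale0r add0r mul1r sub0r.
- by rewrite /sweep /= h1' !subrr !(mul0r, mulr0) addr0 scale0r add0r mul1r sub0r.
Qed.

(** After the deformation sweep, the map F is constant outside the top of the cube,
where it is a based map g.  A null homotopy of g fills the inner cube, with the
height as time, and the deformation fills the collar. *)
Lemma weak_contractible_fillable (X : topologicalType) :
  weak_contractible R X -> sphere_fillable R X.
Proof.
move=> wX j F cF.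
pose V := ('rV[R]_j * R)%type.
pose Q (q : V * R) : V := `|sweep q|^-1 *: sweep q.
pose x0 := F (0, -1).
have cFQ : {within @sphere1 R V `*` [set s : R | 0 <= s <= 1], continuous (F \o Q)}.
  apply: (within_comp _ _ cF).
    by move=> [u s] [/= u1 s01]; apply: norm_normalize; exact: sweep_neq0.
  apply: continuous_in_subspaceT => -[u s] /set_mem [/= u1 s01].
  apply: (@continuous_comp _ _ _ (@sweep 'rV[R]_j) (fun v : V => `|v|^-1 *: v)).
    exact: sweep_continuous.
  by apply: normalize_continuous; exact: sweep_neq0.
have top w : @ball1 R 'rV[R]_j w -> @sphere1 R V (w, 1).
  by move=> w1; apply/prod_norm_eq; rewrite /= normr1; split => //; right.
have Qside (u : V) : sphere1 u -> u.2 <> 1 \/ `|u.1| = 1 -> F (Q (u, 1)) = x0.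
  move=> u1 uJ; rewrite /Q sweep1_sides // /x0; congr F.
  have -> : `|(0, -1) : V| = 1.
    by apply/prod_norm_eq; rewrite /= normrN normr1 normr0; split => //; right.
  by rewrite invr1 scale1r.
pose g (t : 'rV[R]_j) := F (Q ((cube_to_ball t, 1), 1)).
have bg : based_maps x0 g.
  split=> [|t tb].
    apply: (@within_eq _ _ _ ((F \o Q) \o (fun t => ((cube_to_ball t, 1), 1)))) => //.
    apply: (within_comp _ _ cFQ).
      move=> t /cube_ball tc; split=> /=; first exact: top.
      by rewrite lexx ler01.
    apply: within_pair; last by apply: continuous_subspaceT => t; exact: cst_continuous.
    apply: within_pair; last by apply: continuous_subspaceT => t; exact: cst_continuous.
    by apply: continuous_subspaceT; exact: cube_to_ball_continuous.
  move/cube_boundary_sphere: tb => tb; apply: Qside; last by right.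
  by apply: top; rewrite /ball1 /= tb.
have [K [cK K0 K1 Kb]] := based_null_homotopic wX bg.
apply: (@collar_extension _ V _ _
  (fun p : V => K (ball_to_cube p.1, 2^-1 * (1 - p.2))) (F \o Q)) => //.
- move=> u u1; rewrite /= /Q sweep0; congr F.
  by rewrite [`|u|]u1 invr1 scale1r.
- apply: (within_comp (f := fun p : V => (ball_to_cube p.1, 2^-1 * (1 - p.2))) _ _ cK).
    move=> p; rewrite /ball1 /= prod_norm_le => /andP[p1 p2]; split=> /=.
      exact: cube_of_ball.
    by move: p2; rewrite ler_norml in_itv /=; lra.
  apply: within_pair; apply: continuous_subspaceT => p.
    by apply: continuous_comp; [exact: cvg_fst|exact: ball_to_cube_continuous].
  apply: cvgM; first exact: cvg_cst.
  by apply: cvgB; [exact: cvg_cst|exact: cvg_snd].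
- move=> [w h] u1; rewrite /=.
  have [w1 h1 wh] := (prod_norm_eq _ _).1 u1.
  have cw : cube (ball_to_cube w) by apply: cube_of_ball.
  have [e|ne] := eqVneq h 1.
    rewrite e subrr mulr0 K0 //.
    by rewrite /g ball_to_cubeK.
  rewrite Qside //; last by left; apply/eqP.
  case: wh => /= [r1|hh].
    have tb : cube_boundary (ball_to_cube w).
      by apply/cube_boundary_sphere; rewrite ball_to_cubeK.
    rewrite Kb //; last by move: h1; rewrite ler_norml /=; lra.
    by case: bg => _ ->.
  have -> : h = -1.
    by move: hh ne; case: ler0P => _ hh; [lra | rewrite hh eqxx].
  have -> : 2^-1 * (1 - -1) = 1 :> R by lra.
  by rewrite K1.
Qed.
End weak.

(** * The triangulated cube *)

Lemma mem_prism (S T : eqType) (a b : S -> T) s w x :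
  w \in prism a b s -> x \in w -> exists2 v, v \in s & x = a v \/ x = b v.
Proof.
elim: s w => //= v s IH w; rewrite in_cons => /orP[/eqP -> |/mapP[w' w's ->]].
  rewrite !in_cons => /or3P[/eqP ->|/eqP ->|/mapP[v' v's ->]].
  - by exists v; [rewrite mem_head|left].
  - by exists v; [rewrite mem_head|right].
  - by exists v'; [rewrite in_cons v's orbT|right].
rewrite in_cons => /orP[/eqP ->|/(IH _ w's)[v' v's e]].
  by exists v; [rewrite mem_head|left].
by exists v' => //; rewrite in_cons v's orbT.
Qed.

Lemma size_prism (S T : eqType) (a b : S -> T) s w :
  w \in prism a b s -> size w = (size s).+1.
Proof.
elim: s w => //= v s IH w; rewrite in_cons => /orP[/eqP -> |/mapP[w' /IH w's ->]].
  by rewrite /= size_map.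
by rewrite /= w's.
Qed.

(** Every simplex of a prism contains both ends of a vertical edge. *)
Lemma prism_degenerate (S T U : eqType) (a b : S -> T) (h : T -> U) s w :
  (forall v, v \in s -> h (a v) = h (b v)) ->
  w \in prism a b s -> uniq (map h w) = false.
Proof.
elim: s w => //= v s IH w hab; rewrite in_cons => /orP[/eqP -> |/mapP[w' w's ->]].
  by rewrite /= hab ?mem_head // in_cons eqxx.
rewrite /= (IH w') ?andbF // => v' v's; apply: hab.
by rewrite in_cons v's orbT.
Qed.

Lemma map_prism (S T U : Type) (a b : S -> T) (f : T -> U) s :
  map (map f) (prism a b s) = prism (f \o a) (f \o b) s.
Proof.
by elim: s => //= v s <-; rewrite -!map_comp.
Qed.

Lemma prism_map (S T U : Type) (a b : T -> U) (f : S -> T) s :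
  prism a b (map f s) = prism (a \o f) (b \o f) s.
Proof. by elim: s => //= v s ->; rewrite -!map_comp. Qed.

Lemma eq_prism (S T : Type) (a b a' b' : S -> T) s :
  a =1 a' -> b =1 b' -> prism a b s = prism a' b' s.
Proof.
move=> ea eb; elim: s => //= v s ->.
by rewrite ea eb (eq_map eb).
Qed.

Section grid.
Variable R : realType.

Definition consr j (x : R) (t : 'rV[R]_j) : 'rV[R]_j.+1 :=
  \row_i (if unlift ord0 i is Some k then t ord0 k else x).
Definition headr j (v : 'rV[R]_j.+1) : R := v ord0 ord0.
Definition tailr j (v : 'rV[R]_j.+1) : 'rV[R]_j := \row_k v ord0 (lift ord0 k).

Lemma consr0 j x (t : 'rV[R]_j) : consr x t ord0 ord0 = x.
Proof. by rewrite mxE unlift_none. Qed.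

Lemma consrS j x (t : 'rV[R]_j) k : consr x t ord0 (lift ord0 k) = t ord0 k.
Proof. by rewrite mxE liftK. Qed.

Lemma tailr_continuous j : continuous (@tailr j).
Proof.
apply: mx_continuous => i k.
have -> : (fun v => @tailr j v i k) = fun v => v ord0 (lift ord0 k).
  by apply/funext => v; rewrite mxE.
exact: coord_continuous.
Qed.

Lemma headr_consr j x (t : 'rV[R]_j) : headr (consr x t) = x.
Proof. exact: consr0. Qed.

Lemma tailr_consr j x (t : 'rV[R]_j) : tailr (consr x t) = t.
Proof. by apply/rowP => k; rewrite mxE consrS. Qed.

Lemma forall_ordS j (P : 'I_j.+1 -> Prop) :
  (forall i, P i) <-> P ord0 /\ forall k : 'I_j, P (lift ord0 k).
Proof.
split=> [h|[h0 h] i]; first by split.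
by case: (unliftP ord0 i) => [k ->|->].
Qed.

Lemma cube_ordS j (v : 'rV[R]_j.+1) :
  cube v <-> 0 <= headr v <= 1 /\ cube (tailr v).
Proof.
rewrite /cube /= forall_ordS; split=> -[h0 h]; split=> // k; have := h k;
  by rewrite mxE.
Qed.

Lemma cube_consr j x (t : 'rV[R]_j) : 0 <= x <= 1 -> cube t -> cube (consr x t).
Proof. by move=> x01 ct; apply/cube_ordS; rewrite headr_consr tailr_consr. Qed.

Lemma boundary_consr_tail j x (t : 'rV[R]_j) :
  0 <= x <= 1 -> cube_boundary t -> cube_boundary (consr x t).
Proof.
move=> x01 [ct [i ti]]; split; first exact: cube_consr.
by exists (lift ord0 i); rewrite consrS.
Qed.

Lemma boundary_consr_head j x (t : 'rV[R]_j) :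
  x = 0 \/ x = 1 -> cube t -> cube_boundary (consr x t).
Proof.
move=> x01 ct; split.
  by apply: cube_consr => //; case: x01 => ->; rewrite ?lexx ?ler01.
by exists ord0; rewrite consr0.
Qed.

Definition antipode j (t : 'rV[R]_j) : 'rV[R]_j := const_mx 1 - t.

Lemma antipodeK j : involutive (@antipode j).
Proof. by move=> t; rewrite /antipode opprB addrC subrK. Qed.

Lemma antipode_cube j (t : 'rV[R]_j) : cube t -> cube (antipode t).
Proof. by move=> ct i; have := ct i; rewrite !mxE; lra. Qed.

Lemma antipode_boundary j (t : 'rV[R]_j) :
  cube_boundary t -> cube_boundary (antipode t).
Proof.
move=> [ct [i ti]]; split; first exact: antipode_cube.
by exists i; rewrite !mxE; case: ti => ->; [right|left]; rewrite ?subr0 ?subrr.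
Qed.

Lemma antipode_consr j x (t : 'rV[R]_j) :
  antipode (consr x t) = consr (1 - x) (antipode t).
Proof.
by apply/rowP => i; rewrite !mxE; case: unliftP => [k _|_] //; rewrite !mxE.
Qed.

(** The hyperplane at height s/K of the new first coordinate. *)
Definition layer (K s : nat) j : 'rV[R]_j -> 'rV[R]_j.+1 := consr (s%:R / K%:R).

(** The cube, cut into K^j small cubes, each one triangulated by iterated prisms. *)
Fixpoint grid (K j : nat) : seq (seq 'rV[R]_j) :=
  if j is j'.+1 then
    flatten [seq flatten [seq prism (@layer K s j') (@layer K s.+1 j') u
                         | u <- grid K j'] | s <- index_iota 0 K]
  else [:: [:: 0]].

Definition evalc j (phi : seq 'rV[R]_j -> bool) (c : seq (seq 'rV[R]_j)) : bool :=
  \big[addb/false]_(u <- c) phi u.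

Lemma evalc_gridS K j (phi : seq 'rV[R]_j.+1 -> bool) :
  evalc phi (grid K j.+1) =
  \big[addb/false]_(0 <= s < K)
     evalc (coprism (@layer K s j) (@layer K s.+1 j) phi) (grid K j).
Proof.
rewrite /evalc /= big_flatten big_map; apply: eq_bigr => s _.
by rewrite big_flatten big_map.
Qed.

Lemma telescope_addb (p : nat -> bool) n :
  \big[addb/false]_(0 <= s < n) (p s (+) p s.+1) = p 0%N (+) p n.
Proof.
elim: n => [|n IH]; first by rewrite big_geq ?addbb.
by rewrite big_nat_recr //= IH addbA addbK.
Qed.

Lemma evalc_cobd_gridS K j (phi : seq 'rV[R]_j.+1 -> bool) :
  evalc (cobd phi) (grid K j.+1) =
  evalc (fun u => phi (map (@layer K 0 j) u)) (grid K j) (+)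
  evalc (fun u => phi (map (@layer K K j) u)) (grid K j) (+)
  \big[addb/false]_(0 <= s < K)
     evalc (cobd (coprism (@layer K s j) (@layer K s.+1 j) phi)) (grid K j).
Proof.
rewrite evalc_gridS -(telescope_addb (fun s =>
  evalc (fun u => phi (map (@layer K s j) u)) (grid K j))) -big_split /=.
apply: eq_bigr => s _; rewrite /evalc -!big_split /=.
by apply: eq_bigr => u _; exact: coprism_cobd.
Qed.

Lemma layer_ge0_le1 (K s : nat) : (0 < K)%N -> (s <= K)%N -> 0 <= (s%:R / K%:R : R) <= 1.
Proof.
move=> K0 sK; rewrite divr_ge0 ?ler0n //= ler_pdivrMr ?ltr0n // mul1r ler_nat //.
Qed.

Lemma mem_gridS K j u : u \in grid K j.+1 ->
  exists s w, [/\ (s < K)%N, w \in grid K j & u \in prism (@layer K s j) (@layer K s.+1 j) w].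
Proof.
move=> /flattenP[_ /mapP[s sK ->]] /flattenP[_ /mapP[w wg ->] uw].
by exists s, w; split => //; move: sK; rewrite mem_index_iota.
Qed.

Lemma grid_size K j u : u \in grid K j -> size u = j.+1.
Proof.
elim: j u => [|j IH] u; first by rewrite inE => /eqP ->.
by move=> /mem_gridS[s [w [_ /IH sw /size_prism ->]]]; rewrite sw.
Qed.

Lemma grid_cube K j u t : (0 < K)%N -> u \in grid K j -> t \in u -> cube t.
Proof.
move=> K0; elim: j u t => [|j IH] u t.
  by rewrite inE => /eqP -> _ [].
move=> /mem_gridS[s [w [sK /IH wc uw]]] /(mem_prism uw)[v /wc cv].
by case=> ->; apply: cube_consr => //; apply: layer_ge0_le1 => //; exact: ltnW.
Qed.

Definition close_rows (K : nat) j (t t' : 'rV[R]_j) : Prop :=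
  forall i, `|t ord0 i - t' ord0 i| <= K%:R^-1.

Lemma close_consr K j x x' (t t' : 'rV[R]_j) :
  `|x - x'| <= K%:R^-1 -> close_rows K t t' -> close_rows K (consr x t) (consr x' t').
Proof.
move=> xx tt; apply/forall_ordS; rewrite !consr0; split=> // k.
by rewrite !consrS.
Qed.

Lemma grid_close K j u t t' : (0 < K)%N ->
  u \in grid K j -> t \in u -> t' \in u -> close_rows K t t'.
Proof.
move=> K0; elim: j u t t' => [|j IH] u t t'.
  by move=> _ _ _ [].
move=> /mem_gridS[s [w [sK /IH wc uw]]] /(mem_prism uw)[v vw tv] /(mem_prism uw)[v' v'w tv'].
have KR : 0 < (K%:R^-1 : R) by rewrite invr_gt0 ltr0n.
by case: tv => ->; case: tv' => ->; (apply: close_consr; last exact: wc);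
  rewrite -mulrBl -?[s.+1]addn1 ?natrD normrM (gtr0_norm KR)
    ?subrr ?normr0 ?mul0r ?(ltW KR) //
    ?opprD ?addrA ?subrr ?sub0r ?normrN ?[_%:R + 1]addrC ?addrK ?normr1 ?mul1r.
Qed.

(** Modulo 2, the boundary of the triangulated cube lies in the boundary of the cube. *)
Lemma cobd_grid_boundary K j (phi : seq 'rV[R]_j -> bool) : (0 < K)%N ->
  (forall u, (forall t, t \in u -> cube_boundary t) -> phi u = false) ->
  evalc (cobd phi) (grid K j) = false.
Proof.
move=> K0; elim: j phi => [|j IH] phi phi0.
  by rewrite /evalc big_seq1 cobd_cons phi0 // /cobd big_nil.
have layer0 : (0%:R / K%:R : R) = 0 by rewrite mul0r.
have layerK : (K%:R / K%:R : R) = 1 by rewrite divff // pnatr_eq0 -lt0n.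
have end0 s : (s%:R / K%:R : R) = 0 \/ (s%:R / K%:R : R) = 1 ->
    evalc (fun u => phi (map (@layer K s j) u)) (grid K j) = false.
  move=> s01; rewrite /evalc big1_seq // => u /= /(grid_cube K0) uc.
  by apply: phi0 => _ /mapP[t /uc ct ->]; exact: boundary_consr_head.
rewrite evalc_cobd_gridS end0; last by left.
rewrite end0; last by right.
rewrite big1_seq // => s /=; rewrite mem_index_iota => /andP[_ sK].
apply: IH => u ub; rewrite /coprism big1_seq // => w /= wu.
apply: phi0 => t /(mem_prism wu)[v /ub vb].
by case=> ->; apply: boundary_consr_tail => //; apply: layer_ge0_le1 => //; exact: ltnW.
Qed.

(** The central symmetry of the cube permutes the simplices of the triangulation and
reverses the order of their vertices. *)
Lemma evalc_grid_antipode K j (phi : seq 'rV[R]_j -> bool) : (0 < K)%N ->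
  evalc (fun u => phi (rev (map (@antipode j) u))) (grid K j) = evalc phi (grid K j).
Proof.
move=> K0; elim: j phi => [|j IH] phi.
  rewrite /evalc !big_seq1; congr phi; congr [:: _].
  by apply/rowP => -[].
have KR : (K%:R : R) != 0 by rewrite pnatr_eq0 -lt0n.
have flip s : (s <= K)%N -> @antipode j.+1 \o @layer K s j =1 @layer K (K - s) j \o @antipode j.
  move=> sK t; rewrite /= /layer antipode_consr natrB // mulrBl divff //.
rewrite !evalc_gridS [RHS]big_nat_rev /= add0n.
apply: eq_big_nat => s /andP[_ sK].
rewrite -(IH (coprism _ _ phi)); apply: eq_bigr => u _.
have -> : (K - s.+1).+1 = (K - s)%N by rewrite subnSK.
rewrite -[RHS](coprism_rev) revK /coprism prism_map.
rewrite -(eq_prism _ (flip s _) (flip s.+1 _)) //; last exact: ltnW.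
by rewrite -map_prism big_map.
Qed.

(** * Equivariant hemispheres *)

Section equivariant.
Variables (X : topologicalType) (tau : X -> X).
Hypotheses (tau_cont : continuous tau) (tauK : involutive tau).
Hypothesis fillX : sphere_fillable R X.

(** The boundary condition is what makes f and tau f, glued along antipodal boundary
points, into an equivariant map from the j-sphere. *)
Definition hemisphere j (f : 'rV[R]_j -> X) : Prop :=
  {within @cube R j, continuous f} /\
  forall t, cube_boundary t -> f (antipode t) = tau (f t).

Definition odd_labelling (lab : X -> nat) (K j : nat) (f : 'rV[R]_j -> X) : Prop :=
  (forall t, cube t -> lab (tau (f t)) = opp_label (lab (f t))) /\
  (forall t t', cube t -> cube t' -> close_rows K t t' ->
     (lab (f t))./2 = (lab (f t'))./2 -> lab (f t) = lab (f t')).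

(** Ky Fan's lemma along the equivariant construction: the number of alternating
simplices is odd.  By cobd_alternates, it is congruent to the number of boundary
facets of the (j+1)-cube which alternate and start with the sign false.  The
bottom carries the labels of f_j and the top the opposite labels at the antipodal
points, so together they give all the alternating simplices of f_j.  On the sides
the labels are constant in the direction of the homotopy, and no facet alternates. *)
Lemma hemisphere_alternating (x0 : X) j : exists f : 'rV[R]_j -> X,
  hemisphere f /\
  forall K (lab : X -> nat), (0 < K)%N -> odd_labelling lab K f ->
    evalc (fun u => alt_labels false (map (lab \o f) u) (+)
                    alt_labels true (map (lab \o f) u)) (grid K j).
Proof.
elim: j => [|j [f [[cf fb] hf]]].
  exists (cst x0); split.
    split; first by apply: continuous_subspaceT => t; exact: cst_continuous.
    by move=> t [_ [[]]].
  move=> K lab K0 _; rewrite /evalc big_seq1 /alt_labels /=.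
  by case: odd.
pose g t := tau (f (antipode t)).
have cg : {within @cube R j, continuous g}.
  apply: (@within_eq _ _ _ (tau \o (f \o @antipode j))) => //.
  apply: (within_comp (B := setT)) => //.
    apply: (within_comp _ _ cf); first exact: antipode_cube.
    apply: continuous_subspaceT.
    have -> : @antipode j = fun t => -1 *: t + const_mx 1.
      by apply/funext => t; rewrite /antipode scaleN1r addrC.
    exact: (@affine_continuous _ 'rV[R]_j).
  exact: continuous_subspaceT.
have fg t : cube_boundary t -> f t = g t by move=> tb; rewrite /g fb // tauK.
have [H [cH H0 H1 Hb]] := fillable_homotopy fillX cf cg fg.
pose f' (v : 'rV[R]_j.+1) := H (tailr v, headr v).
have f'E x t : f' (consr x t) = H (t, x) by rewrite /f' tailr_consr headr_consr.
have vE (v : 'rV[R]_j.+1) : v = consr (headr v) (tailr v).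
  apply/rowP => i; rewrite mxE; case: unliftP => [k ->|->] //.
  by rewrite mxE.
exists f'; split.
  split.
    apply: (within_comp (f := fun v => (tailr v, headr v)) _ _ cH).
      by move=> v /cube_ordS[? ?]; split => //=; rewrite in_itv.
    by apply: within_pair; apply: continuous_subspaceT; [exact: tailr_continuous|exact: coord_continuous].
  move=> v; rewrite (vE v) antipode_consr !f'E.
  move: (headr v) (tailr v) => x t [/cube_ordS[]].
  rewrite headr_consr tailr_consr => x01 ct [i].
  have cat := antipode_cube ct.
  case: (unliftP ord0 i) => [k ->|->].
    rewrite consrS => tk.
    have tb : cube_boundary t by split => //; exists k.
    have atb := antipode_boundary tb.
    by rewrite !Hb ?fb //; lra.
  rewrite consr0 => -[->|->].
    by rewrite subr0 H0 // H1 // /g antipodeK.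
  by rewrite subrr H0 // H1 // /g tauK.
move=> K lab K0 [opp_f' close_f'].
have c0 t : cube t -> cube (consr 0 t).
  by move=> ct; apply: cube_consr => //; rewrite lexx ler01.
have f'0 t : cube t -> f' (consr 0 t) = f t by move=> ct; rewrite f'E H0.
have flab : odd_labelling lab K f.
  split=> [t ct|t t' ct ct' tt']; first by rewrite -f'0 // opp_f' //; exact: c0.
  rewrite -!f'0 //; apply: close_f'; [exact: c0|exact: c0|].
  apply: close_consr => //; rewrite subrr normr0 invr_ge0 //.
have layer0 : (0%:R / K%:R : R) = 0 by rewrite mul0r.
have layerK : (K%:R / K%:R : R) = 1 by rewrite divff // pnatr_eq0 -lt0n.
pose phi (u : seq 'rV[R]_j.+1) := alt_labels false (map (lab \o f') u).
transitivity (evalc (cobd phi) (grid K j.+1)).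
  by apply: eq_bigr => u _; rewrite -cobd_alt_labels cobd_map.
rewrite evalc_cobd_gridS.
rewrite [X in _ (+) X]big1_seq ?addbF; last first.
  move=> s /=; rewrite mem_index_iota => /andP[_ sK].
  apply: cobd_grid_boundary => // u ub; rewrite /coprism big1_seq // => w /= wu.
  apply/negP => /alt_labels_uniq.
  rewrite (prism_degenerate _ wu) // => t /ub tb.
  by rewrite /layer /= !f'E !Hb // layer_ge0_le1 // ltnW.
rewrite -(hf K lab K0 flab) /evalc big_split /=; congr (_ (+) _).
  apply: eq_big_seq => u /(grid_cube K0) uc; rewrite /phi -map_comp.
  congr alt_labels; apply/eq_in_map => t /uc ct /=.
  by rewrite /layer layer0 f'0.
pose psi (u : seq 'rV[R]_j) := alt_labels false (map opp_label (map (lab \o f) u)).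
transitivity (evalc (fun u => psi (rev (map (@antipode j) u))) (grid K j)).
  apply: eq_big_seq => u /(grid_cube K0) uc.
  have -> : psi (rev (map (@antipode j) u)) =
      alt_labels false (map opp_label (map (lab \o f) (map (@antipode j) u))).
    by rewrite /psi !map_rev; apply: alt_labels_perm; rewrite perm_rev.
  rewrite /phi -!map_comp; congr alt_labels; apply/eq_in_map => t /uc ct /=.
  by rewrite /layer layerK f'E H1 // /g; case: flab => ->//; exact: antipode_cube.
rewrite evalc_grid_antipode //; apply: eq_big_seq => u ug; rewrite /psi.
rewrite alt_labels_opp // => _ _ /mapP[t tu ->] /mapP[t' t'u ->].
case: flab => _; apply; [exact: grid_cube ug tu|exact: grid_cube ug t'u|].
exact: grid_close ug tu t'u.
Qed.
End equivariant.
End grid.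

(** * The Borsuk-Ulam theorem for fillable spaces *)

Lemma compact_pos_bound (R : realType) (T : topologicalType) (C : set T) (u : T -> R) :
  compact C -> {within C, continuous u} -> (forall x, C x -> 0 < u x) ->
  exists2 e : R, 0 < e & forall x, C x -> e <= u x.
Proof.
move=> cC cu u0; have [->|/set0P C0] := eqVneq C set0; first by exists 1.
have [c /set_mem Cc cmin] := compact_EVT_min C0 cC cu.
by exists (u c); [exact: u0|move=> x Cx; apply: cmin; exact: mem_set].
Qed.

Section borsuk_ulam.
Variable R : realType.

Lemma cube_compact j : compact (@cube R j).
Proof.
have -> : @cube R j = [set v : 'rV[R]_j | forall i, v ord0 i \in `[0, 1]].
  by apply/seteqP; split=> v /= vc i; have := vc i; rewrite /= in_itv.
have seg (i : 'I_j) : compact (`[0, 1]%classic : set R) by exact: segment_compact.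
by have := @rV_compact _ _ (fun=> `[(0 : R), 1]%classic) seg.
Qed.

(** On the compact set of pairs (t, t') with |f t - f t'| >= e the distance |t - t'| is
bounded below. *)
Lemma cube_unif_continuous j (f : 'rV[R]_j -> R) (e : R) :
  {within @cube R j, continuous f} -> 0 < e ->
  exists2 K, (0 < K)%N & forall t t', cube t -> cube t' -> close_rows K t t' ->
    `|f t - f t'| < e.
Proof.
move=> cf e0.
pose D := [set p : 'rV[R]_j * 'rV[R]_j | e <= `|f p.1 - f p.2|].
pose CC := @cube R j `*` @cube R j.
have cCC : compact CC by apply: compact_setX; exact: cube_compact.
have cf2 : {within CC, continuous (fun p : 'rV[R]_j * 'rV[R]_j => `|f p.1 - f p.2|)}.
  have c1 : {within CC, continuous (f \o fst)}.
    apply: (within_comp _ _ cf); first by move=> p [].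
    by apply: continuous_subspaceT => p; exact: cvg_fst.
  have c2 : {within CC, continuous (f \o snd)}.
    apply: (within_comp _ _ cf); first by move=> p [].
    by apply: continuous_subspaceT => p; exact: cvg_snd.
  by move=> p; apply: cvg_norm; apply: cvgB; [exact: c1|exact: c2].
have cD : compact (CC `&` D).
  have : closed (D : set (subspace CC)).
    apply: (closed_comp (f := from_subspace CC (fun p : 'rV[R]_j * 'rV[R]_j => `|f p.1 - f p.2|))
      (D := [set x : R | e <= x])); last exact: closed_ge.
    by move=> p _; exact: cf2.
  move=> /closed_subspaceP[W cW eW].
  rewrite setIC -eW; apply: (subclosed_compact _ cCC); last exact: subIsetr.
    apply: closedI => //; apply: closedI.
      by apply: (closed_comp _ (@closed_cube R j)) => p _; exact: cvg_fst.
    by apply: (closed_comp _ (@closed_cube R j)) => p _; exact: cvg_snd.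
have [d d0 hd] : exists2 d : R, 0 < d & forall p, (CC `&` D) p -> d <= `|p.1 - p.2|.
  apply: compact_pos_bound => //.
    apply: continuous_subspaceT => p; apply: cvg_norm.
    by apply: cvgB; [exact: cvg_fst|exact: cvg_snd].
  move=> p [_ Dp]; rewrite normr_gt0 subr_eq0; apply/eqP => pp.
  by move: Dp; rewrite /D /= pp subrr normr0 leNgt e0.
exists (Num.truncn d^-1).+1 => // t t' ct ct' tt'.
rewrite ltNge; apply/negP => De.
have := hd (t, t') (conj (conj ct ct') De); rewrite /= leNgt => /negP; apply.
have K0 : 0 < ((Num.truncn d^-1).+1%:R : R) by rewrite ltr0n.
apply: (@le_lt_trans _ _ ((Num.truncn d^-1).+1%:R^-1)).
  by apply/rV_norm_le; [rewrite invr_ge0 ltW|move=> i; have := tt' i; rewrite !mxE].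
rewrite invf_plt ?posrE //.
exact: truncnS_gt.
Qed.

(** If the functions have no common zero on the image of f, label x by an index i with
|Phi_i(x)| maximal and by the sign of Phi_i(x).  On a fine grid neighbouring points
do not have opposite labels, so there is an alternating simplex; but its N + 1
vertices would need N + 1 different indices. *)
Theorem borsuk_ulam (X : topologicalType) (tau : X -> X) (x0 : X) :
  continuous tau -> involutive tau -> sphere_fillable R X ->
  forall N, exists2 f : 'rV[R]_N -> X, {within @cube R N, continuous f} &
    forall Phi : 'I_N -> X -> R,
      (forall i, continuous (Phi i)) ->
      (forall i x, Phi i (tau x) = - Phi i x) ->
      exists2 t, cube t & forall i, Phi i (f t) = 0.
Proof.
move=> ct tK fX N; have [f [[cf fb] hf]] := hemisphere_alternating ct tK fX x0 N.
exists f => // Phi cPhi oPhi; apply: contrapT => noz.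
case: N f cf fb hf Phi cPhi oPhi noz => [|N] f cf fb hf Phi cPhi oPhi noz.
  by apply: noz; exists 0 => -[].
have cPf i : {within @cube R N.+1, continuous (Phi i \o f)}.
  apply: (within_comp (B := setT)) cf _ => //.
  by apply: continuous_subspaceT; exact: cPhi.
pose m t := \sum_i `|Phi i (f t)|.
have [e e0 em] : exists2 e : R, 0 < e & forall t, cube t -> e <= m t.
  apply: compact_pos_bound; first exact: cube_compact.
    apply: (continuous_big add_continuous) => i _ t; apply: cvg_norm; exact: cPf.
  move=> t ct'; rewrite lt_def sumr_ge0 ?andbT => [|i _ //].
  apply/eqP => /eqP; rewrite psumr_eq0 // => /allP z.
  apply: noz; exists t => // i.
  by have := z i (mem_index_enum _); rewrite normr_eq0 => /eqP.
pose lead x := [arg max_(i > ord0 : 'I_N.+1) `|Phi i x|]%O.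
have leadP x i : `|Phi i x| <= `|Phi (lead x) x|.
  by rewrite /lead; case: arg_maxP => // k _; apply.
pose d := e / N.+1%:R.
have d0 : 0 < d by rewrite divr_gt0 // ltr0n.
have lead_ge t : cube t -> d <= `|Phi (lead (f t)) (f t)|.
  move=> ct'; rewrite ler_pdivrMr ?ltr0n //; apply: le_trans (em t ct') _.
  rewrite -[N.+1 in leRHS]card_ord mulr_natr -sumr_const.
  by apply: ler_sum => i _; exact: leadP.
pose lab x := ((lead x).*2 + (Phi (lead x) x < 0)%R)%N.
have labh x : (lab x)./2 = lead x.
  by rewrite /lab addnC half_bit_double.
have labo x : odd (lab x) = (Phi (lead x) x < 0) by rewrite /lab oddD odd_double oddb.
have lead_tau x : lead (tau x) = lead x.
  rewrite /lead.
  have -> : (fun i => `|Phi i (tau x)|) = (fun i => `|Phi i x|).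
    by apply/funext => i; rewrite oPhi normrN.
  by [].
have [K K0 hK] : exists2 K, (0 < K)%N & forall i t t', cube t -> cube t' ->
    close_rows K t t' -> `|Phi i (f t) - Phi i (f t')| < d.
  have /choice[k hk] i : exists K, (0 < K)%N /\ forall t t', cube t -> cube t' ->
      close_rows K t t' -> `|Phi i (f t) - Phi i (f t')| < d.
    by have [K] := cube_unif_continuous (cPf i) d0; exists K.
  exists (\max_i k i).+1 => // i t t' ct1 ct2 tt'; apply: (hk i).2 => // l.
  apply: le_trans (tt' l) _; rewrite lef_pV2 ?posrE ?ltr0n ?(hk i).1 // ler_nat.
  by rewrite leqW // (leq_bigmax i).
have odd_lab : odd_labelling tau lab K f.
  split=> [t ct1|t t' ct1 ct2 tt'].
    rewrite /opp_label labh labo /lab lead_tau oPhi oppr_lt0; congr (_ + nat_of_bool _)%N.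
    have := lead_ge t ct1; move: (Phi _ _) => r rd; rewrite -leNgt [RHS]le_eqVlt.
    by case: eqP => // r0; move: rd; rewrite -r0 normr0 leNgt d0.
  rewrite !labh => /val_inj ll; rewrite /lab -ll; congr (_ + nat_of_bool _)%N.
  have := hK (lead (f t)) t t' ct1 ct2 tt'.
  have := lead_ge t ct1; have := lead_ge t' ct2; rewrite -ll.
  move: (Phi _ _) (Phi _ _) => r s; clear -d0.
  by case: (ltrP r 0) => r0; case: (ltrP s 0) => s0 //;
     rewrite ?(ltr0_norm r0) ?(ltr0_norm s0) ?(ger0_norm r0) ?(ger0_norm s0);
     case: ler0P; lra.
have := hf K lab K0 odd_lab; rewrite /evalc big1_seq // => u /= ug.
have cs : consistent (map (lab \o f) u).
  move=> _ _ /mapP[t tu ->] /mapP[t' t'u ->]; apply: odd_lab.2.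
  - exact: grid_cube ug tu.
  - exact: grid_cube ug t'u.
  - exact: grid_close ug tu t'u.
have sm : {in map (lab \o f) u, forall x, (x < (N.+1).*2)%N}.
  move=> _ /mapP[t _ ->]; rewrite /= /lab.
  by have := ltn_ord (lead (f t)); case: (_ < 0); lia.
by rewrite !(alt_labels_size _ cs sm) // size_map (grid_size ug).
Qed.
End borsuk_ulam.

(** * Coloured covers *)

Lemma dist_continuous (R : realType) (T : topologicalType) (V : normedModType R)
    (f g : T -> V) : continuous f -> continuous g ->
  continuous (fun x => `|f x - g x|).
Proof. by move=> cf cg x; apply: cvg_norm; apply: cvgB; [exact: cf|exact: cg]. Qed.

Section coloured.
Variables (R : realType) (M : topologicalType) (d : M -> M -> R).
Hypotheses (d_xx : forall x, d x x = 0) (d_sym : forall x y, d x y = d y x)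
  (d_tri : forall x y z, d x z <= d x y + d y z)
  (d_cont : continuous (fun p : M * M => d p.1 p.2)).

(** The set F i is the union of the members of colour i, and c i x is the name of the
member that contains x.  Members of the same colour keep the distance eta. *)
Definition coloured_cover (I : Type) (A : set M) (eps : R) : Prop :=
  exists (F : I -> set M) (c : I -> M -> nat) (eta : R),
  [/\ 0 < eta, forall i, compact (F i), A `<=` \bigcup_i F i,
      forall i x y, F i x -> F i y -> c i x = c i y -> d x y < eps &
      forall i x y, F i x -> F i y -> c i x <> c i y -> eta <= d x y].

(** For a compact set A with the metric d and for n + 1 colours, this is Ostrand's
characterization of covering dimension at most n. *)
Definition finely_colourable (I : Type) (A : set M) : Prop :=
  forall eps : R, 0 < eps -> coloured_cover I A eps.

Lemma d_ge0 x y : 0 <= d x y.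
Proof. by have := d_tri x y x; rewrite d_xx (d_sym y x); lra. Qed.

Lemma finely_colourable0 (I : Type) : finely_colourable I set0.
Proof.
move=> eps e0; exists (fun=> set0), (fun _ _ => 0%N), 1; split=> //.
by move=> _; exact: compact0.
Qed.

(** Start with a cover of B.  Choose the cover of A so fine that each of its members is
close to at most one member of B of the same colour, and merge those that are
close to such a member into it.  Merging enlarges the members of B only slightly,
and the colours remain separated. *)
Lemma finely_colourableU (I : Type) (A B : set M) :
  finely_colourable I A -> finely_colourable I B -> finely_colourable I (A `|` B).
Proof.
move=> hA hB eps e0.
have [|FV [cV [etaV [etaV0 FVc BV smallV gapV]]]] := hB (eps / 3); first by lra.
(* A merged point lies within 2 th of its member of B, so that two merged points
   are compared with an error of at most 4 th; 24 leaves enough room. *)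
pose th := Num.min etaV eps / 24.
have th0 : 0 < th by rewrite divr_gt0 // lt_min etaV0 e0.
have thV : 24 * th <= etaV.
  by rewrite /th mulrC divfK ?pnatr_eq0 // ge_min lexx.
have the : 24 * th <= eps.
  by rewrite /th mulrC divfK ?pnatr_eq0 // ge_min lexx orbT.
have [FU [cU [etaU [etaU0 FUc AU smallU gapU]]]] := hA th th0.
pose absorbed i x v := FV i v /\
  (v = x \/ ~ FV i x /\ exists y, [/\ FU i y, cU i y = cU i x & d v y < th]).
pose c i x : nat := if pselect (exists v, absorbed i x v) is left h
  then (cV i (projT1 (cid h))).*2 else (cU i x).*2.+1.
have cP i x : FU i x \/ FV i x ->
    (exists v, [/\ absorbed i x v, FV i v, d x v < 2 * th & c i x = (cV i v).*2]) \/
    [/\ FU i x, ~ (exists v, absorbed i x v) & c i x = (cU i x).*2.+1].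
  move=> Fx; rewrite /c; case: pselect => [h|h]; last first.
    right; split => //; case: Fx => // Fx; exfalso; apply: h.
    by exists x; split => //; left.
  left; case: (cid h) => v /= xv; exists v; split => //; first by case: xv.
  case: xv => Fv [->|[Fx' [y [Fy yx vy]]]]; first by rewrite d_xx; lra.
  have Ux : FU i x by case: Fx.
  have := smallU i y x Fy Ux yx; have := d_tri x y v.
  by rewrite (d_sym x y) (d_sym y v); lra.
exists (fun i => FU i `|` FV i), c, (Num.min th etaU); split.
- by rewrite lt_min th0.
- by move=> i; apply: compactU.
- by move=> x [/AU|/BV] [i _ Fx]; exists i => //; [left|right].
- move=> i x y /cP[[v [av Fv xv ->]]|[Ux _ ->]] /cP[[w [aw Fw yw ->]]|[Uy _ ->]].
  + move=> /double_inj /(smallV i v w Fv Fw) vw.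
    by have := d_tri x v y; have := d_tri v w y; rewrite (d_sym w y); lra.
  + by lia.
  + by lia.
  + by move=> [/double_inj /(smallU i x y Ux Uy)]; lra.
- have far i x v y : absorbed i x v -> FU i x \/ FV i x -> FU i y ->
      ~ (exists v, absorbed i y v) -> Num.min th etaU <= d x y.
    move=> [Fv xv] Fx Uy ay; rewrite ge_min.
    have Vy : ~ FV i y by move=> Vy; apply: ay; exists y; split => //; left.
    have [Vx|Vx] := pselect (FV i x).
      apply/orP; left; rewrite leNgt; apply/negP => xy; apply: ay; exists x.
      by split => //; right; split => //; exists y.
    have Ux : FU i x by case: Fx.
    apply/orP; right; apply: (gapU i) => // xy; apply: ay; exists v; split => //.
    case: xv => [vx|[_ [z [Fz zx vz]]]]; first by move: Vx; rewrite -vx.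
    by right; split => //; exists z; split => //; rewrite zx.
  move=> i x y Fx Fy.
  case: (cP i x Fx) => [[v [av Fv xv ->]]|[Ux ax ->]];
  case: (cP i y Fy) => [[w [aw Fw yw ->]]|[Uy ay ->]] ne.
  + have vw : cV i v <> cV i w by move=> e; apply: ne; rewrite e.
    have := gapV i v w Fv Fw vw; rewrite ge_min.
    have := d_tri v x w; have := d_tri x y w; rewrite (d_sym v x).
    by move=> h1 h2 h3; apply/orP; left; lra.
  + exact: far av Fx Uy ay.
  + by rewrite d_sym; exact: far aw Fy Ux ax.
  + have xy : cU i x <> cU i y by move=> e; apply: ne; rewrite e.
    by rewrite ge_min (gapU i x y) // orbT.
Qed.

(** The union of the intervals [2 z + b, 2 z + b + 1] over the integers z, written as
the complement of a union of open intervals. *)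
Definition stripes (b : bool) : set R :=
  [set r | forall z : int, ~ (z%:~R + 2^-1 < (r - b%:R) / 2 < z%:~R + 1)].

Lemma closed_stripes b : closed (stripes b).
Proof.
have -> : stripes b = ~` \bigcup_(z in [set: int])
    [set r | z%:~R + 2^-1 < (r - b%:R) / 2 < z%:~R + 1].
  apply/seteqP; split=> r h; first by move=> [z _]; exact: h.
  by move=> z hz; apply: h; exists z.
apply: open_closedC; apply: bigcup_open => z _.
have c : continuous (fun r : R => (r - b%:R) / 2).
  move=> r; apply: cvgM; last exact: cvg_cst.
  by apply: cvgB; [exact: cvg_id|exact: cvg_cst].
have -> : [set r | z%:~R + 2^-1 < (r - b%:R) / 2 < z%:~R + 1] =
   (fun r : R => (r - b%:R) / 2) @^-1` `]z%:~R + 2^-1, z%:~R + 1[%classic.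
  by apply/seteqP; split=> r /=; rewrite in_itv.
by apply: open_comp => [r _|]; [exact: c|exact: interval_open].
Qed.

Definition stripe_index (b : bool) (r : R) : int := Num.floor ((r - b%:R) / 2).

Lemma stripes_floor b r : stripes b r ->
  (stripe_index b r)%:~R <= (r - b%:R) / 2 <= (stripe_index b r)%:~R + 2^-1.
Proof.
move=> /(_ (stripe_index b r)); rewrite /stripe_index; move: ((r - _) / 2) => v h.
rewrite floor_le_tmp //= leNgt; apply/negP => hv; apply: h.
by rewrite hv /= -intrD1 floorD1_gt.
Qed.

Lemma stripes_cover r : exists b, stripes b r.
Proof.
pose z := Num.floor (r / 2).
have z1 : z%:~R <= r / 2 by exact: floor_le_tmp.
have z2 : r / 2 < z%:~R + 1 by rewrite -intrD1 floorD1_gt.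
have [h|h] := leP (r / 2) (z%:~R + 2^-1).
  exists false => k /=; rewrite subr0 => /andP[k1 k2].
  have : (k%:~R : R) < z%:~R by lra.
  have : (z%:~R : R) < (k + 1)%:~R by rewrite intrD; lra.
  by rewrite !ltr_int; lia.
exists true => k /= /andP[k1 k2].
have : (k%:~R : R) < z%:~R by lra.
have : (z%:~R : R) < (k + 1)%:~R by rewrite intrD; lra.
by rewrite !ltr_int; lia.
Qed.

Lemma stripe_index_eq b r r' : stripes b r -> stripes b r' ->
  stripe_index b r = stripe_index b r' -> `|r - r'| <= 1.
Proof.
by move=> /stripes_floor h /stripes_floor h' e; move: h h'; rewrite e ler_norml; lra.
Qed.

Lemma stripe_index_neq b r r' : stripes b r -> stripes b r' ->
  stripe_index b r <> stripe_index b r' -> 1 <= `|r - r'|.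
Proof.
move=> /stripes_floor h /stripes_floor h' e.
have : ((stripe_index b r + 1 <= stripe_index b r') || (stripe_index b r' + 1 <= stripe_index b r))%R.
  by move: e; lia.
case/orP; rewrite -(ler_int R) intrD => ?; rewrite ler_normr; apply/orP; [right|left]; lra.
Qed.

(** Cut the space of values of e into small cubes and colour each cube by the parities
of its coordinates; different cubes of the same colour are apart.  By
compactness, points with close values of e are close in the sense of d. *)
Lemma finely_colourable_chart m (B : set M) (e : M -> 'rV[R]_m) :
  compact B -> continuous e -> (forall x y, `|e x - e y| <= d x y) ->
  (forall x y, B x -> B y -> e x = e y -> d x y = 0) ->
  finely_colourable {ffun 'I_m -> bool} B.
Proof.
move=> cB ce e_le_d inje eps eps0.
have cBB : compact (B `*` B) by exact: compact_setX.
have [de de0 hde] : exists2 de : R, 0 < de &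
    forall x y, B x -> B y -> `|e x - e y| <= de -> d x y < eps.
  pose D := (B `*` B) `&` [set p | eps <= d p.1 p.2].
  have cD : compact D.
    apply: compact_closedI => //.
    apply: (closed_comp (f := fun p : M * M => d p.1 p.2) (D := [set x : R | eps <= x])).
      by move=> p _; exact: d_cont.
    exact: closed_ge.
  have [a a0 ha] : exists2 a : R, 0 < a & forall p, D p -> a <= `|e p.1 - e p.2|.
    apply: compact_pos_bound => //.
      apply: continuous_subspaceT.
      apply: (dist_continuous (f := e \o fst) (g := e \o snd)) => p.
        by apply: continuous_comp; [exact: cvg_fst|exact: ce].
      by apply: continuous_comp; [exact: cvg_snd|exact: ce].
    move=> [x y] [[/= Bx By] dxy]; rewrite normr_gt0 subr_eq0; apply/eqP => exy.
    by move: dxy; rewrite /= inje // leNgt eps0.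
  exists (a / 2); first by lra.
  move=> x y Bx By exy; rewrite ltNge; apply/negP => dxy.
  by have := ha (x, y) (conj (conj Bx By) dxy); rewrite /=; lra.
pose s x i := e x ord0 i / de.
pose F (k : {ffun 'I_m -> bool}) := B `&` [set x | forall i, stripes (k i) (s x i)].
pose c (k : {ffun 'I_m -> bool}) x := pickle [ffun i => stripe_index (k i) (s x i)].
have sE x y i : `|e x ord0 i - e y ord0 i| = `|s x i - s y i| * de.
  by rewrite -mulrBl normrM normfV (gtr0_norm de0) mulfVK // gt_eqF.
have cs i : continuous (s^~ i).
  move=> x; apply: cvgM; last exact: cvg_cst.
  apply: (@continuous_comp _ _ _ e (fun v : 'rV[R]_m => v ord0 i)); first exact: ce.
  exact: coord_continuous.
exists F, c, de; split=> //.
- move=> k; apply: compact_closedI => //.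
  have -> : [set x | forall i, stripes (k i) (s x i)] =
      \bigcap_(i in [set: 'I_m]) ((s^~ i) @^-1` stripes (k i)).
    by apply/seteqP; split=> x h i => [_|]; exact: h.
  apply: closed_bigI => i _; apply: closed_comp; last exact: closed_stripes.
  by move=> x _; exact: cs.
- move=> x Bx.
  have /choice[k hk] i := stripes_cover (s x i).
  by exists [ffun i => k i] => //; split => // i; rewrite ffunE; exact: hk.
- move=> k x y [Bx sx] [By sy] /(pcan_inj pickleK) /ffunP cxy.
  apply: hde => //; apply/rV_norm_le; first exact: ltW.
  move=> i; rewrite !mxE sE; apply: ler_piMl; first exact: ltW.
  by apply: stripe_index_eq (sx i) (sy i) _; have := cxy i; rewrite !ffunE.
- move=> k x y [Bx sx] [By sy] cxy.
  have [i si] : exists i, stripe_index (k i) (s x i) <> stripe_index (k i) (s y i).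
    apply: contrapT => /forallNP h; apply: cxy; congr pickle.
    by apply/ffunP => i; rewrite !ffunE; apply: contrapT; exact: h.
  apply: le_trans (e_le_d x y).
  apply: le_trans ((rV_norm_le (e x - e y) (normr_ge0 _)).1 (lexx _) i).
  rewrite !mxE sE; apply: ler_peMl; first exact: ltW.
  exact: stripe_index_neq (sx i) (sy i) si.
Qed.

Lemma d_continuousr x : continuous (d x).
Proof.
move=> y; apply: (@continuous_comp _ _ _ (fun z => (x, z)) (fun p : M * M => d p.1 p.2)).
  by apply: pair_continuous_at; [exact: cst_continuous|exact: cvg_id].
exact: d_cont.
Qed.

Lemma d_near x (e : R) : 0 < e -> \forall y \near x, d x y < e.
Proof.
move=> e0; have /cvgrPdist_lt /(_ e e0) : d x y @[y --> x] --> d x x.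
  exact: d_continuousr.
by apply: filterS => y; rewrite d_xx sub0r normrN ger0_norm // d_ge0.
Qed.

Lemma lipschitz_continuous (h : M -> R) (L : R) : 0 <= L ->
  (forall x y, h x <= h y + L * d x y) -> continuous h.
Proof.
move=> L0 hL x; apply/cvgrPdist_lt => e e0.
have L1 : 0 < L + 1 by lra.
apply: filterS (d_near x (divr_gt0 e0 L1)) => y.
rewrite ltr_pdivlMr // => dxy.
have := hL x y; have := hL y x; rewrite (d_sym y x) => h1 h2.
have := d_ge0 x y => d0.
by rewrite ltr_norml; nra.
Qed.

(** The extension is h x = inf (c q + L d(x,q)), the largest function with the Lipschitz
constant L that agrees with c on F. *)
Lemma mcshane_extension (F : set M) (c : M -> R) (L : R) : F !=set0 -> 0 <= L ->
  (forall x, F x -> 0 <= c x) ->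
  (forall x y, F x -> F y -> c x <= c y + L * d x y) ->
  exists h : M -> R, [/\ forall x y, h x <= h y + L * d x y,
    forall x, F x -> h x = c x &
    forall x a, (forall q, F q -> a <= c q + L * d x q) -> a <= h x].
Proof.
move=> [q0 Fq0] L0 c0 cL.
pose S x := [set c q + L * d x q | q in F].
have lbS x : lbound (S x) 0.
  by move=> _ [q Fq <-]; rewrite addr_ge0 ?c0 // mulr_ge0 // d_ge0.
have S0 x : S x !=set0 by exists (c q0 + L * d x q0); exists q0.
have hle x q : F q -> inf (S x) <= c q + L * d x q.
  by move=> Fq; apply: ge_inf; [exists 0; exact: lbS|exists q].
have leh x a : (forall q, F q -> a <= c q + L * d x q) -> a <= inf (S x).
  by move=> ha; apply: lb_le_inf => // _ [q Fq <-]; exact: ha.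
exists (fun x => inf (S x)); split => //.
- move=> x y; rewrite -lerBlDr; apply: leh => q Fq.
  have := hle x q Fq; have : L * d x q <= L * (d x y + d y q) by rewrite ler_wpM2l.
  by rewrite mulrDr; lra.
- move=> x Fx; apply/eqP; rewrite eq_le; apply/andP; split.
    by apply: le_trans (hle x x Fx) _; rewrite d_xx mulr0 addr0.
  by apply: leh => q Fq; exact: cL.
Qed.

(** One function is the distance to F, which detects F up to points at distance zero.
The other one extends c, which is Lipschitz on the compact set F because it is
bounded there and its jumps are spread over the distance eta. *)
Lemma colour_functions (F : set M) (c : M -> nat) (eta eps : R) :
  compact F -> 0 < eta -> 0 < eps ->
  (forall x y, F x -> F y -> c x = c y -> d x y < eps) ->
  (forall x y, F x -> F y -> c x <> c y -> eta <= d x y) ->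
  exists a b : M -> R, [/\ continuous a, continuous b &
    forall x y, F x -> a x = a y -> b x = b y -> d x y < eps].
Proof.
move=> cF eta0 eps0 small gap.
have [F0|/set0P F0] := eqVneq F set0.
  exists (cst 0), (cst 0); split; [exact: cst_continuous|exact: cst_continuous|].
  by move=> x y; rewrite F0.
have [z /set_mem Fz zmax] : exists2 z, z \in F &
    forall x, x \in F -> ((c x)%:R : R) <= (c z)%:R.
  apply: (compact_EVT_max F0 cF (f := fun x => (c x)%:R)).
  apply/subspace_continuousP => x Fx; apply: cvg_near_cst.
  have near_eq : \forall y \near x, F y -> ((c y)%:R : R) = (c x)%:R.
    apply: filterS (d_near x eta0) => y dxy Fy; congr _%:R.
    apply: contrapT => cyx; have := gap x y Fx Fy (fun e => cyx (esym e)).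
    by rewrite leNgt dxy.
  exact: near_eq.
pose L : R := (c z)%:R / eta.
have L0 : 0 <= L by rewrite divr_ge0 ?ler0n // ltW.
have cL x y : F x -> F y -> ((c x)%:R : R) <= (c y)%:R + L * d x y.
  move=> Fx Fy; have := d_ge0 x y => d0.
  have [->|/eqP ne] := eqVneq (c x) (c y); first by rewrite lerDl mulr_ge0.
  apply: le_trans (zmax x (mem_set Fx)) _.
  apply: (@le_trans _ _ (L * d x y)); last by rewrite lerDr ler0n.
  rewrite -[leLHS](divfK (lt0r_neq0 eta0)).
  by rewrite ler_wpM2l //; exact: gap.
have [a [aL aF aI]] := @mcshane_extension F (cst 0) 1 F0 ler01
  (fun _ _ => lexx _) (fun x y _ _ => addr_ge0 (lexx _) (mulr_ge0 ler01 (d_ge0 x y))).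
have [b [bL bF _]] := @mcshane_extension F (fun x => (c x)%:R) L F0 L0
  (fun _ _ => ler0n _ _) cL.
exists a, b; split.
- exact: lipschitz_continuous aL.
- exact: lipschitz_continuous bL.
move=> x y Fx; rewrite aF // => /esym ay; rewrite bF // => /esym by_.
have [q Fq yq] : exists2 q, F q & d y q = 0.
  apply: contrapT => nq.
  have [e e0 he] : exists2 e : R, 0 < e & forall q, F q -> e <= d y q.
    apply: compact_pos_bound => //; first by apply: continuous_subspaceT; exact: d_continuousr.
    move=> q Fq; rewrite lt_def d_ge0 andbT; apply/eqP => yq.
    by apply: nq; exists q.
  have : e <= a y by apply: aI => q Fq; rewrite /= add0r mul1r he.
  by rewrite ay /= leNgt e0.
have cxq : c x = c q.
  apply/eqP; rewrite -(eqr_nat R) -(bF q Fq) -by_; apply/eqP.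
  have := bL y q; have := bL q y; rewrite (d_sym q y) yq mulr0 !addr0 => h1 h2.
  by apply/eqP; rewrite eq_le h1 h2.
have := small x q Fx Fq cxq; have := d_tri x q y; rewrite (d_sym q y) yq; lra.
Qed.

Lemma coloured_cover_functions (I : Type) (A : set M) (eps : R) : 0 < eps ->
  coloured_cover I A eps ->
  exists phi : I * bool -> M -> R, (forall i, continuous (phi i)) /\
    forall x y, A x -> (forall i, phi i x = phi i y) -> d x y < eps.
Proof.
move=> eps0 [F [c [eta [eta0 cF AF small gap]]]].
have /choice[ab hab] i : exists ab : (M -> R) * (M -> R),
    [/\ continuous ab.1, continuous ab.2 &
     forall x y, F i x -> ab.1 x = ab.1 y -> ab.2 x = ab.2 y -> d x y < eps].
  have [a [b h]] := colour_functions (cF i) eta0 eps0 (small i) (gap i).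
  by exists (a, b).
exists (fun k => if k.2 then (ab k.1).1 else (ab k.1).2); split.
  by move=> [i []] /=; case: (hab i).
move=> x y /AF[i _ Fx] e; case: (hab i) => _ _; apply=> //.
  exact: (e (i, true)).
exact: (e (i, false)).
Qed.
End coloured.

(** * Separating functions on a manifold *)

Lemma scale_continuous (R : realType) (T : topologicalType) (V : normedModType R)
    (s : T -> R) (f : T -> V) : continuous s -> continuous f ->
  continuous (fun x => s x *: f x).
Proof. by move=> cs cf x; apply: cvgZ; [exact: cs|exact: cf]. Qed.

Lemma consr_continuous (R : realType) j (x : R) : continuous (@consr R j x).
Proof.
apply: mx_continuous => i k; case: (unliftP ord0 k) => [l ->|->].
  have -> : (fun v => @consr R j x v i (lift ord0 l)) = fun v => v ord0 l.
    by apply/funext => v; rewrite mxE liftK.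
  exact: coord_continuous.
have -> : (fun v => @consr R j x v i ord0) = cst x.
  by apply/funext => v; rewrite mxE unlift_none.
exact: cst_continuous.
Qed.

Section manifold.
Variables (R : realType) (n : nat) (M : topologicalType).
Hypothesis hM : topological_manifold R n M.

(** Multiply the chart f, extended by the coordinate 1, by a bump function chi that is
supported in a ball around f x.  As the ball is compact and M is a Hausdorff space, the
result extends continuously by zero to all of M; it determines chi, hence also f
where chi is positive. *)
Lemma chart_function (x : M) : exists (e : M -> 'rV[R]_n.+1) (C : set M),
  [/\ continuous e, closed C, nbhs x C &
      forall y z, C y -> e y = e z -> y = z].
Proof.
have [U [V [oU Ux oV [f [g [[cf cg] [fUV gVU] gf fg]]]]]] :=
  manifold_locally_euclidean hM x.
have Vfx : V (f x) by exact: fUV.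
have /nbhs_ballP[r0 /= r00 r0V] : nbhs (f x) V by exact: open_nbhs_nbhs.
pose r := r0 / 2.
have r_gt0 : 0 < r by rewrite divr_gt0.
pose D := [set v : 'rV[R]_n | `|v - f x| <= r].
have DV : D `<=` V.
  move=> v Dv; apply: r0V; rewrite -ball_normE /= distrC.
  by apply: le_lt_trans Dv _; rewrite /r; lra.
have cfD : continuous (fun v : 'rV[R]_n => `|v - f x|).
  by apply: dist_continuous; [move=> v; exact: cvg_id|exact: cst_continuous].
have cD : compact D.
  apply: bounded_closed_compact.
    exists (r + `|f x|); split; first exact: num_real.
    move=> b rb v Dv; apply: le_trans (ltW rb).
    have -> : v = (v - f x) + f x by rewrite subrK.
    by apply: le_trans (ler_normD _ _) _; rewrite lerD2r.
  apply: (closed_comp (f := fun v : 'rV[R]_n => `|v - f x|) (D := [set y : R | y <= r])).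
    by move=> v _; exact: cfD.
  exact: closed_le.
have cgD : closed (g @` D).
  apply: compact_closed; first exact: manifold_hausdorff hM.
  apply: continuous_compact cD; exact: continuous_subspaceW cg.
have gDU : g @` D `<=` U by move=> _ [v Dv <-]; apply: gVU; exact: DV.
pose chi p := Num.max 0 (r - `|f p - f x|).
pose e p := if pselect (U p) then chi p *: consr 1 (f p) else 0.
have eU p : U p -> e p = chi p *: consr 1 (f p) by rewrite /e; case: pselect.
have eN p : ~ (g @` D) p -> e p = 0.
  move=> nD; rewrite /e; case: pselect => // Up.
  rewrite /chi max_l ?scale0r // subr_le0 leNgt; apply/negP => h; apply: nD.
  by exists (f p); [exact: ltW|exact: gf].
have fc p : U p -> {for p, continuous f}.
  by move=> Up; move: cf; rewrite continuous_open_subspace // => /(_ p (mem_set Up)).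
pose G (v : 'rV[R]_n) := Num.max 0 (r - `|v - f x|) *: consr 1 v.
have cG : continuous G.
  have cm : continuous (fun v : 'rV[R]_n => Num.max 0 (r - `|v - f x|)).
    have cr : continuous (fun t : R => Num.max 0 (r - t)).
      move=> t; apply: (continuous_max (f := cst 0) (g := fun t => r - t)).
        exact: cst_continuous.
      by apply: cvgB; [exact: cvg_cst|exact: cvg_id].
    by move=> v; apply: (@continuous_comp _ _ _ (fun v : 'rV[R]_n => `|v - f x|) (fun t => Num.max 0 (r - t))); [exact: cfD|exact: cr].
  exact: (scale_continuous cm (@consr_continuous R n 1)).
have ec : continuous e.
  move=> p; have [Up|nUp] := pselect (U p); last first.
    have np : ~ (g @` D) p by move=> /gDU.
    have nn : \forall q \near p, e q = 0.
      have : nbhs p (~` (g @` D)) by apply: open_nbhs_nbhs; split => //; exact: closed_openC.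
      by apply: filterS => q; exact: eN.
    rewrite /continuous_at (eN _ np); exact: cvg_near_cst nn.
  have cc : {for p, continuous (fun q => chi q *: consr 1 (f q))}.
    apply: (@continuous_comp _ _ _ f G); [exact: fc|exact: cG].
  have nn : \forall q \near p, chi q *: consr 1 (f q) = e q.
    have : nbhs p U by exact: open_nbhs_nbhs.
    by apply: filterS => q Uq; rewrite eU.
  rewrite /continuous_at eU //; apply: cvg_trans cc.
  exact: near_eq_cvg.
have e0U p : U p -> e p ord0 ord0 = chi p.
  by move=> Up; rewrite eU // mxE consr0 mulr1.
have e0_pos p : r / 2 <= e p ord0 ord0 -> U p.
  move=> ep; apply: contrapT => nUp; move: ep; rewrite eN; last by move=> /gDU.
  by rewrite mxE; lra.
have ce0 : continuous (fun p => e p ord0 ord0).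
  move=> p; apply: (@continuous_comp _ _ _ e (fun v : 'rV[R]_n.+1 => v ord0 ord0)).
    exact: ec.
  exact: coord_continuous.
exists e, [set p | r / 2 <= e p ord0 ord0]; split => //.
- apply: (closed_comp (f := fun p => e p ord0 ord0) (D := [set y : R | r / 2 <= y])).
    by move=> p _; exact: ce0.
  exact: closed_ge.
- have : nbhs x ((fun p => e p ord0 ord0) @^-1` [set y : R | r / 2 < y]).
    apply: open_nbhs_nbhs; split; first by apply: open_comp => [p _|]; [exact: ce0|exact: open_gt].
    rewrite /= e0U // /chi subrr normr0 subr0 max_r ?ltW //; lra.
  by apply: filterS => p /ltW.
- move=> y z Cy eyz; have Cz : r / 2 <= e z ord0 ord0 by rewrite -eyz.
  have Uy := e0_pos y Cy; have Uz := e0_pos z Cz.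
  have chi_eq : chi y = chi z by rewrite -!e0U // eyz.
  have z0 : 0 < chi z by rewrite -e0U //; lra.
  rewrite -(gf y Uy) -(gf z Uz); congr g.
  move: eyz; rewrite !eU // chi_eq => /(scalerI (lt0r_neq0 z0)) h.
  by rewrite -(tailr_consr 1 (f y)) h tailr_consr.
Qed.

(** The functions of finitely many charts define a pseudo-distance d on M which is a
distance on the compact set K.  The pieces of K in the charts are finely
colourable with 2^(n+1) colours, hence so is K, and the functions attached to a
fine coloured cover separate p t and q t.  The bound N on their number depends on
n alone. *)
Lemma separating_functions :
  exists N, forall j (p q : 'rV[R]_j -> M),
    {within @cube R j, continuous p} -> {within @cube R j, continuous q} ->
    (forall t, cube t -> p t <> q t) ->
    exists phi : 'I_N -> M -> R, (forall i, continuous (phi i)) /\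
      forall t, cube t -> exists i, phi i (p t) <> phi i (q t).
Proof.
pose I := {ffun 'I_n.+1 -> bool}.
exists #|{: I * bool}| => j p q cp cq pq.
have /choice[eC heC] (x : M) : exists eC : (M -> 'rV[R]_n.+1) * set M,
    [/\ continuous eC.1, closed eC.2, nbhs x eC.2 &
     forall y z, eC.2 y -> eC.1 y = eC.1 z -> y = z].
  by have [e [C h]] := chart_function x; exists (e, C).
pose K := p @` @cube R j `|` q @` @cube R j.
have cK : compact K.
  by apply: compactU; apply: continuous_compact => //; exact: cube_compact.
have [s sK] : exists s : seq M, K `<=` \bigcup_(x in [set` s]) (eC x).2.
  have [K0|[x0 _]] : K = set0 \/ K !=set0.
    by have [|/set0P] := eqVneq K set0; [left|right].
    by exists [::]; rewrite K0.
  pose pM : ptopologicalType := HB.pack (M : Type) M (isPointed.Build M x0).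
  have : @compact pM K by exact: cK.
  rewrite compact_cover => /(_ M K (fun x => (eC x).2^°)) [].
  - by move=> x _; exact: open_interior.
  - by move=> x Kx; exists x => //; case: (heC x).
  move=> s _ sK; exists (finmap.enum_fset s) => x /sK[y ys /interior_subset h].
  by exists y.
pose d x y := \sum_(z <- s) `|(eC z).1 x - (eC z).1 y|.
have d_xx x : d x x = 0 by rewrite /d big1 // => z _; rewrite subrr normr0.
have d_sym x y : d x y = d y x by apply: eq_bigr => z _; rewrite distrC.
have d_tri x y z : d x z <= d x y + d y z.
  rewrite /d -big_split; apply: ler_sum => w _; exact: ler_distD.
have d_cont : continuous (fun w : M * M => d w.1 w.2).
  apply: (continuous_big add_continuous) => z _; have [ce _ _ _] := heC z.
  apply: (dist_continuous (f := (eC z).1 \o fst) (g := (eC z).1 \o snd)) => w.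
    by apply: continuous_comp; [exact: cvg_fst|exact: ce].
  by apply: continuous_comp; [exact: cvg_snd|exact: ce].
have d_ge z x y : z \in s -> `|(eC z).1 x - (eC z).1 y| <= d x y.
  by move=> zs; rewrite /d (big_rem z) //= lerDl sumr_ge0.
have d_sep x y : K x -> d x y = 0 -> x = y.
  move=> /sK[z zs zx] dxy; have [_ _ _] := heC z; apply => //.
  by apply/eqP; rewrite -subr_eq0 -normr_le0 -dxy d_ge.
have colK : finely_colourable d I K.
  have : K `<=` \bigcup_(x in [set` s]) (K `&` (eC x).2).
    by move=> x Kx; have [z zs zx] := sK x Kx; exists z.
  suff h (s' : seq M) : {subset s' <= s} ->
      finely_colourable d I (\bigcup_(x in [set` s']) (K `&` (eC x).2)).
    move=> KK eps eps0; have [F [c [eta [h1 h2 h3 h4 h5]]]] := h s (fun _ => id) eps eps0.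
    by exists F, c, eta; split => // x /KK /h3.
  elim: s' => [|z s' IH] ss.
    by rewrite set_nil bigcup_set0; exact: finely_colourable0.
  have -> : \bigcup_(x in [set` z :: s']) (K `&` (eC x).2) =
      (K `&` (eC z).2) `|` \bigcup_(x in [set` s']) (K `&` (eC x).2).
    apply/seteqP; split=> [y [w /=]|y [zy|[w /= ws wy]]].
    - by rewrite in_cons => /orP[/eqP ->|ws] wy; [left|right; exists w].
    - by exists z => //=; rewrite mem_head.
    - by exists w => //=; rewrite in_cons ws orbT.
  apply: finely_colourableU => //; last first.
    by apply: IH => x xs; apply: ss; rewrite in_cons xs orbT.
  have zs : z \in s by apply: ss; rewrite mem_head.
  have [ce cC _ inj] := heC z.
  apply: (finely_colourable_chart d_cont (e := (eC z).1)) => //.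
  - exact: compact_closedI.
  - by move=> x y; exact: d_ge.
  - by move=> x y [_ zx] _ /(inj _ _ zx) ->.
have [eps eps0 heps] : exists2 eps : R, 0 < eps & forall t, cube t -> eps <= d (p t) (q t).
  apply: compact_pos_bound; first exact: cube_compact.
    apply: (within_comp (B := setT) (f := fun t => (p t, q t)) (g := fun w : M * M => d w.1 w.2)) => //.
      exact: within_pair.
    exact: continuous_subspaceT.
  move=> t ct; rewrite lt_def d_ge0 // andbT; apply/eqP => dpq.
  by apply: (pq t ct); apply: d_sep dpq; left; exists t.
have [phi [cphi sphi]] := coloured_cover_functions d_xx d_sym d_tri d_cont eps0 (colK eps eps0).
exists (fun k => phi (enum_val k)); split=> [i|t ct]; first exact: cphi.
apply: contrapT => /forallNP h.
have Kp : K (p t) by left; exists t.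
have : d (p t) (q t) < eps.
  apply: sphi => // i; apply: contrapT => hi.
  by apply: (h (enum_rank i)); rewrite enum_rankK.
by rewrite ltNge heps.
Qed.
End manifold.

(** * Configuration spaces *)

Lemma manifold_points (R : realType) (n : nat) (M : topologicalType) (k : nat) :
  (1 <= n)%N -> topological_manifold R n M -> [set: M] !=set0 ->
  exists p : 'I_k -> M, injective p.
Proof.
move=> n1 hM [x _].
have [U [V [oU Ux oV [f [g [[cf cg] [fUV gVU] gf fg]]]]]] :=
  manifold_locally_euclidean hM x.
have /nbhs_ballP[r /= r0 rV] : nbhs (f x) V by apply: open_nbhs_nbhs; split => //; exact: fUV.
pose a (i : nat) : R := r / 2 / i.+1%:R.
have a0 i : 0 < a i by rewrite !divr_gt0 // ltr0n.
pose v (i : 'I_k) := f x + a i *: const_mx 1.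
have Vv i : V (v i).
  apply: rV; rewrite -ball_normE /= opprD addrA subrr sub0r normrN.
  apply: (@le_lt_trans _ _ (r / 2)); last by lra.
  apply/rV_norm_le; first by lra.
  move=> l; rewrite !mxE mulr1 gtr0_norm // ler_pdivrMr ?ltr0n //.
  by rewrite ler_peMr ?ler1n //; lra.
exists (g \o v) => i j /= gij.
have : v i = v j by rewrite -(fg _ (Vv i)) -(fg _ (Vv j)) gij.
move=> /addrI /rowP /(_ (Ordinal n1)); rewrite !mxE !mulr1 => /mulfI.
move=> /(_ (lt0r_neq0 (divr_gt0 r0 (ltr0n _ 2)))) /invr_inj /eqP.
by rewrite eqr_nat eqSS => /eqP /val_inj.
Qed.

Lemma prod_topology_continuous (I : eqType) (K : I -> topologicalType)
    (T : topologicalType) (f : T -> prod_topology K) :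
  (forall i, continuous (fun x => f x i)) -> continuous f.
Proof.
move=> cf x; apply/cvg_sup => i.
exact: (@continuous_comp_initial _ _ _ (@proj I K i) f (cf i)).
Qed.

Section configurations.
Variables (M : topologicalType) (k : nat).
Let X := configuration_space M k.

Definition point_at (i : 'I_k) (x : X) : M := set_val x i.

Lemma point_at_continuous i : continuous (point_at i).
Proof.
move=> x; apply: (@continuous_comp _ _ _ (set_val : X -> _) (@proj _ (fun=> M) i)).
  exact: initial_continuous.
exact: proj_continuous.
Qed.

Lemma point_at_neq (x : X) i j : i <> j -> point_at i x <> point_at j x.
Proof. exact: (set_valP x). Qed.

Lemma configurationE (x y : X) : point_at^~ x =1 point_at^~ y -> x = y.
Proof. by move=> xy; apply: val_inj; apply/funext => i; exact: xy. Qed.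

Lemma permute_config (s : {perm 'I_k}) (x : X) :
  config_set (fun i => point_at (s i) x).
Proof. by move=> i j ij; apply: point_at_neq => /perm_inj. Qed.

Definition permute (s : {perm 'I_k}) (x : X) : X :=
  SigSub (mem_set (@permute_config s x)).

Lemma point_at_permute s x i : point_at i (permute s x) = point_at (s i) x.
Proof. by []. Qed.

Lemma permute_continuous s : continuous (permute s).
Proof.
apply: continuous_comp_initial; apply: prod_topology_continuous => i.
exact: point_at_continuous.
Qed.

End configurations.

Lemma not_fillable (R : realType) (n : nat) (M : topologicalType) (k : nat) :
  (2 <= k)%N -> topological_manifold R n M -> configuration_space M k ->
  ~ sphere_fillable R (configuration_space M k).
Proof.
case: k => [|[|k]] // _ hM x0 fX.
pose i0 : 'I_k.+2 := ord0; pose i1 : 'I_k.+2 := lift ord0 ord0.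
have i01 : i0 <> i1 by [].
pose tau := permute (M := M) (tperm i0 i1).
have tauK : involutive tau.
  by move=> x; apply: configurationE => i; rewrite !point_at_permute tpermK.
have [N sepN] := separating_functions hM.
have [f cf hf] := borsuk_ulam x0 (@permute_continuous M _ (tperm i0 i1)) tauK fX N.
have cpf i : {within @cube R N, continuous (point_at i \o f)}.
  apply: (within_comp (B := setT)) cf _ => //.
  by apply: continuous_subspaceT; exact: point_at_continuous.
have [phi [cphi sphi]] := sepN N _ _ (cpf i0) (cpf i1)
  (fun t _ => @point_at_neq M _ (f t) _ _ i01).
pose Phi i (x : configuration_space M k.+2) := phi i (point_at i0 x) - phi i (point_at i1 x).
have [||t ct Phi0] := hf Phi.
- have cphip i (l : 'I_k.+2) : continuous (phi i \o @point_at M _ l).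
    by move=> x; apply: continuous_comp; [exact: point_at_continuous|exact: cphi].
  by move=> i x; exact: (cvgB (cphip i i0 x) (cphip i i1 x)).
- by move=> i x; rewrite /Phi !point_at_permute tpermL tpermR opprB.
have [i] := sphi t ct; apply; apply/eqP; rewrite -subr_eq0; apply/eqP.
exact: Phi0.
Qed.

Local Close Scope ring_scope.

Theorem theorem2p1 (R : realType) (n : nat) (M : topologicalType)
    (hn : (1 <= n)%N) (hM : topological_manifold R n M)
    (hne : [set: M] !=set0) (hconn : connected [set: M])
    (k : nat) (hk : (2 <= k)%N) :
  ~ contractible R (configuration_space M k) /\
  ~ weak_contractible R (configuration_space M k).
Proof.
have [p p_inj] := manifold_points k hn hM hne.
have p_config : config_set (p : prod_topology (fun=> M)) by move=> i j ij /p_inj.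
pose x0 : configuration_space M k := SigSub (mem_set p_config).
split=> h; apply: not_fillable hk hM x0 _.
  exact: contractible_fillable.
exact: weak_contractible_fillable.
Qed.
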